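(* In the setting described in the context, consider the Hamiltonian $\mathtt H=\mathtt N+\mathtt G$ on $\mathbb C^2$. (i) (Resonant normal form, no condition on the frequencies.) Let $S_{\rm res}$ be the homogeneous quartic polynomial $S_{\rm res}=\sum_{|\boldsymbol\alpha+\boldsymbol\beta|=4}S_{\boldsymbol\alpha,\boldsymbol\beta}\mathbf z^{\boldsymbol\alpha}\bar{\mathbf z}^{\boldsymbol\beta}$ with $S_{\boldsymbol\alpha,\boldsymbol\beta}=\mathrm i\,\mathtt G_{\boldsymbol\alpha,\boldsymbol\beta}/(\boldsymbol\omega\cdot(\boldsymbol\alpha-\boldsymbol\beta))$ whenever $\boldsymbol\alpha\neq\boldsymbol\beta$ and $\boldsymbol\omega\cdot(\boldsymbol\alpha-\boldsymbol\beta)\ne 0$ ... more precisely: whenever $\boldsymbol\alpha\ne\boldsymbol\beta$ and $(\boldsymbol\alpha,\boldsymbol\beta)\notin\{((3,0),(0,1)),((0,1),(3,0))\}$, and $S_{\boldsymbol\alpha,\boldsymbol\beta}=0$ otherwise; it solves $\mathtt G+\{S_{\rm res},\mathtt N\}=\bar{\mathtt H}_{4,{\rm res}}$. Then in a sufficiently small neighbourhood of the origin the time-one Hamiltonian flow $\Phi_{\rm res}:=\Phi^1_{S_{\rm res}}$ is a symplectic transformation with $\Phi_{\rm res}(\mathbf z)=\mathbf z+O(\|\mathbf z\|^3)$, and $$\mathtt H\circ\Phi_{\rm res}=\mathtt N+\bar{\mathtt H}_{4,{\rm res}}+R_{\rm res},\qquad R_{\rm res}=O(\|\mathbf z\|^6).$$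 (ii) (Nonresonant normal form.) If $\omega_+\neq 3\omega_-$, let $S$ be the homogeneous quartic polynomial with coefficients $S_{\boldsymbol\alpha,\boldsymbol\beta}=\mathrm i\,\mathtt G_{\boldsymbol\alpha,\boldsymbol\beta}/(\boldsymbol\omega\cdot(\boldsymbol\alpha-\boldsymbol\beta))$ for $\boldsymbol\alpha\neq\boldsymbol\beta$ and $S_{\boldsymbol\alpha,\boldsymbol\alpha}=0$; it solves $\mathtt G+\{S,\mathtt N\}=\bar{\mathtt H}_4$. Then in a sufficiently small neighbourhood of the origin the time-one flow $\Phi_{\rm nonres}:=\Phi^1_S$ is a symplectic transformation with $\Phi_{\rm nonres}(\mathbf z)=\mathbf z+O(\|\mathbf z\|^3)$, and $$\mathtt H\circ\Phi_{\rm nonres}=\mathtt N+\bar{\mathtt H}_4+R,\qquad R=O(\|\mathbf z\|^6).$$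
   Context: Let $\mathtt M$ be a real symmetric positive-definite $2\times2$ matrix, $\mathtt K$ a real diagonal positive-definite $2\times 2$ matrix, and $M_3,N_3\in\mathbb R$. Let $\omega_-^2<\omega_+^2$ be the (distinct, positive) eigenvalues of $\mathtt M^{-1}\mathtt K$, with $0<\omega_-<\omega_+$, $\boldsymbol\omega:=(\omega_-,\omega_+)$, and let $\mathbf\Phi=\begin{pmatrix}\phi_1^-&\phi_1^+\\ \phi_2^-&\phi_2^+\end{pmatrix}$ be a real matrix with $\mathbf\Phi^T\mathtt M\mathbf\Phi=\mathbf I$ and $\mathbf\Phi^T\mathtt K\mathbf\Phi=\mathrm{diag}(\omega_-^2,\omega_+^2)$. Define $f(q_1,q_2)=\tfrac14M_3(\phi_1^-q_1+\phi_1^+q_2)^4+\tfrac14N_3(\phi_2^-q_1+\phi_2^+q_2)^4=\sum_{i+j=4}f_{i,j}q_1^iq_2^j$, with $f_{i,j}=\frac{6}{i!j!}\big((\phi_1^-)^i(\phi_1^+)^jM_3+(\phi_2^-)^i(\phi_2^+)^jN_3\big)$. On $\mathbb C^2\ni\mathbf z=(z_1,z_2)$ set $\mathtt N=\omega_-z_1\bar z_1+\omega_+z_2\bar z_2$ and $\mathtt G=f\big(\tfrac{z_1+\bar z_1}{\sqrt{2\omega_-}},\tfrac{z_2+\bar z_2}{\sqrt{2\omega_+}}\big)=\sum_{|\boldsymbol\alpha+\boldsymbol\beta|=4}\mathtt G_{\boldsymbol\alpha,\boldsymbol\beta}\mathbf z^{\boldsymbol\alpha}\bar{\mathbf z}^{\boldsymbol\beta}$,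 where $\mathbf z^{\boldsymbol\alpha}=z_1^{\alpha_1}z_2^{\alpha_2}$, $|\boldsymbol\alpha+\boldsymbol\beta|=\alpha_1+\alpha_2+\beta_1+\beta_2$, and $$\mathtt G_{\boldsymbol\alpha,\boldsymbol\beta}=\frac{f_{\alpha_1+\beta_1,\alpha_2+\beta_2}}{4(\sqrt{\omega_-})^{\alpha_1+\beta_1}(\sqrt{\omega_+})^{\alpha_2+\beta_2}}\frac{(\alpha_1+\beta_1)!}{\alpha_1!\beta_1!}\frac{(\alpha_2+\beta_2)!}{\alpha_2!\beta_2!}.$$ Set $\bar{\mathtt H}_4:=\sum_{|\boldsymbol\alpha|=2}\mathtt G_{\boldsymbol\alpha,\boldsymbol\alpha}|z_1|^{2\alpha_1}|z_2|^{2\alpha_2}$ and $\bar{\mathtt H}_{4,{\rm res}}:=\bar{\mathtt H}_4+\mathtt G_{(0,1),(3,0)}z_2\bar z_1^3+\mathtt G_{(3,0),(0,1)}z_1^3\bar z_2$. Poisson bracket: $\{F,G\}=\mathrm i\sum_{j=1,2}(\partial_{z_j}F\partial_{\bar z_j}G-\partial_{\bar z_j}F\partial_{z_j}G)$. Hamilton's equations of a Hamiltonian $K$ are $\dot z_j=-\mathrm i\partial_{\bar z_j}K$, $\dot{\bar z}_j=\mathrm i\partial_{z_j}K$; $\Phi^t_K$ denotes the corresponding flow. $\|\mathbf z\|:=\max\{|z_1|,|z_2|\}$. *)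

(* Defs.v *)
(* mathcomp + mathcomp-analysis, complex numbers R[i] from
   mathcomp-real-closed.  C^2 is represented in real coordinates as 'rV[R]_4
   with z_j = x_j + i y_j, x_j = v 0 (cx j), y_j = v 0 (cy j). *)
From mathcomp Require Import all_boot all_order all_algebra.
From mathcomp Require Import complex.
From mathcomp Require Import all_classical all_reals all_analysis.
Set Implicit Arguments. Unset Strict Implicit. Unset Printing Implicit Defensive.
Import Order.TTheory GRing.Theory Num.Theory.
Import numFieldNormedType.Exports.
Local Open Scope ring_scope.
Local Open Scope complex_scope.

Section Defs.
Variable R : realType.

(** real coordinates of C^2 = R^4 *)
Definition cx (j : 'I_2) : 'I_4 := inord (2 * j).
Definition cy (j : 'I_2) : 'I_4 := inord (2 * j + 1).

(** complex coordinate z_j of a point v *)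
Definition zc (v : 'rV[R]_4) (j : 'I_2) : R[i] := (v ord0 (cx j)) +i* (v ord0 (cy j)).

(** modulus of a complex number, and ||z|| = max(|z_1|,|z_2|) *)
Definition cmod (z : R[i]) : R := Num.sqrt (complex.Re z ^+ 2 + complex.Im z ^+ 2).
Definition nrm (v : 'rV[R]_4) : R := Num.max (cmod (zc v 0)) (cmod (zc v 1)).

(** unit vectors in the x_j and y_j directions *)
Definition ex (j : 'I_2) : 'rV[R]_4 := delta_mx ord0 (cx j).
Definition ey (j : 'I_2) : 'rV[R]_4 := delta_mx ord0 (cy j).

(** real directional derivative of a complex-valued F : C^2 -> C *)
Definition dre (F : 'rV[R]_4 -> R[i]) (u v : 'rV[R]_4) : R[i] :=
  (derive (fun w => complex.Re (F w)) v u) +i* (derive (fun w => complex.Im (F w)) v u).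

(** Wirtinger derivatives d/dz_j = (d/dx_j - i d/dy_j)/2, d/dzbar_j = (d/dx_j + i d/dy_j)/2 *)
Definition dz (F : 'rV[R]_4 -> R[i]) (j : 'I_2) (v : 'rV[R]_4) : R[i] :=
  (2^-1)%:C * (dre F (ex j) v - 'i * dre F (ey j) v).
Definition dzb (F : 'rV[R]_4 -> R[i]) (j : 'I_2) (v : 'rV[R]_4) : R[i] :=
  (2^-1)%:C * (dre F (ex j) v + 'i * dre F (ey j) v).

(** Poisson bracket {F,G} = i sum_j (dz_j F dzb_j G - dzb_j F dz_j G) *)
Definition pb (F G : 'rV[R]_4 -> R[i]) (v : 'rV[R]_4) : R[i] :=
  'i * \sum_(j < 2) (dz F j v * dzb G j v - dzb F j v * dz G j v).

(** gam solves Hamilton's equations of K on [0,1]: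
    dz_j/dt = -i dK/dzbar_j,  dzbar_j/dt = i dK/dz_j *)
Definition hamilton_sol (K : 'rV[R]_4 -> R[i]) (gam : R -> 'rV[R]_4) : Prop :=
  ({within `[0, 1], continuous gam})%classic /\
  forall t : R, 0 < t < 1 ->
    derivable gam t 1 /\
    forall j : 'I_2,
      zc ('D_1 gam t) j = - 'i * dzb K j (gam t) /\
      (zc ('D_1 gam t) j)^* = 'i * dz K j (gam t).

(** Phi1 v is the value at time 1 of the Hamiltonian flow of K started at v *)
Definition time_one (K : 'rV[R]_4 -> R[i]) (Phi1 : 'rV[R]_4 -> 'rV[R]_4)
    (v : 'rV[R]_4) : Prop :=
  exists gam : R -> 'rV[R]_4, hamilton_sol K gam /\ gam 0 = v /\ gam 1 = Phi1 v.

(** standard symplectic form on C^2 = R^4: sum_j (dx_j /\ dy_j) *)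
Definition omega2 (u w : 'rV[R]_4) : R :=
  \sum_(j < 2) (u ord0 (cx j) * w ord0 (cy j) - u ord0 (cy j) * w ord0 (cx j)).

(** Phi1 is symplectic at v: differentiable and its differential preserves omega2 *)
Definition symplectic_at (Phi1 : 'rV[R]_4 -> 'rV[R]_4) (v : 'rV[R]_4) : Prop :=
  differentiable Phi1 v /\
  forall u w : 'rV[R]_4, omega2 ('d Phi1 v u) ('d Phi1 v w) = omega2 u w.

(** monomial z^alpha zbar^beta *)
Definition mono (a1 a2 b1 b2 : nat) (v : 'rV[R]_4) : R[i] :=
  zc v 0 ^+ a1 * zc v 1 ^+ a2 * (zc v 0)^* ^+ b1 * (zc v 1)^* ^+ b2.

(** homogeneous quartic polynomial with coefficients c *)
Definition quartic (c : nat -> nat -> nat -> nat -> R[i]) (v : 'rV[R]_4) : R[i] :=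
  \sum_(a1 < 5) \sum_(a2 < 5) \sum_(b1 < 5) \sum_(b2 < 5)
    (if (a1 + a2 + b1 + b2 == 4)%N then c a1 a2 b1 b2 * mono a1 a2 b1 b2 v else 0).

(** ---- the model ---- *)
Variables (Phi : 'M[R]_2) (M3 N3 wm wp : R).

(** f(q1,q2) and its coefficients f_{i,j} *)
Definition ff (q1 q2 : R) : R :=
  4^-1 * M3 * (Phi 0 0 * q1 + Phi 0 1 * q2) ^+ 4
  + 4^-1 * N3 * (Phi 1 0 * q1 + Phi 1 1 * q2) ^+ 4.

Definition fcoef (i j : nat) : R :=
  6 / (i`!%:R * j`!%:R) *
  (Phi 0 0 ^+ i * Phi 0 1 ^+ j * M3 + Phi 1 0 ^+ i * Phi 1 1 ^+ j * N3).

(** N and G as functions on C^2 *)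
Definition Nham (v : 'rV[R]_4) : R[i] :=
  wm%:C * zc v 0 * (zc v 0)^* + wp%:C * zc v 1 * (zc v 1)^*.

Definition Gham (v : 'rV[R]_4) : R[i] :=
  (ff (complex.Re (zc v 0 + (zc v 0)^*) / Num.sqrt (2 * wm))
      (complex.Re (zc v 1 + (zc v 1)^*) / Num.sqrt (2 * wp)))%:C.

Definition Hham (v : 'rV[R]_4) : R[i] := Nham v + Gham v.

(** coefficients G_{alpha,beta} *)
Definition Gc (a1 a2 b1 b2 : nat) : R :=
  fcoef (a1 + b1) (a2 + b2)
    / (4 * Num.sqrt wm ^+ (a1 + b1) * Num.sqrt wp ^+ (a2 + b2))
  * ((a1 + b1)`!%:R / (a1`!%:R * b1`!%:R))
  * ((a2 + b2)`!%:R / (a2`!%:R * b2`!%:R)).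

(** Hbar_4 and Hbar_{4,res} *)
Definition H4bar (v : 'rV[R]_4) : R[i] :=
  \sum_(a1 < 3) \sum_(a2 < 3)
    (if (a1 + a2 == 2)%N then
       (Gc a1 a2 a1 a2)%:C * (zc v 0 * (zc v 0)^*) ^+ a1 * (zc v 1 * (zc v 1)^*) ^+ a2
     else 0).

Definition H4res (v : 'rV[R]_4) : R[i] :=
  H4bar v + (Gc 0 1 3 0)%:C * zc v 1 * (zc v 0)^* ^+ 3
          + (Gc 3 0 0 1)%:C * zc v 0 ^+ 3 * (zc v 1)^*.

(** omega . (alpha - beta) *)
Definition wdot (a1 a2 b1 b2 : nat) : R :=
  wm * (a1%:R - b1%:R) + wp * (a2%:R - b2%:R).

Definition resonant_pair (a1 a2 b1 b2 : nat) : bool :=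
  ((a1, a2, b1, b2) == (3, 0, 0, 1)%N) || ((a1, a2, b1, b2) == (0, 1, 3, 0)%N).

(** coefficients of S_res and S *)
Definition Sres_coef (a1 a2 b1 b2 : nat) : R[i] :=
  if ((a1, a2) != (b1, b2)) && ~~ resonant_pair a1 a2 b1 b2
  then 'i * (Gc a1 a2 b1 b2)%:C / (wdot a1 a2 b1 b2)%:C else 0.

Definition Snr_coef (a1 a2 b1 b2 : nat) : R[i] :=
  if (a1, a2) != (b1, b2)
  then 'i * (Gc a1 a2 b1 b2)%:C / (wdot a1 a2 b1 b2)%:C else 0.

Definition Sres := quartic Sres_coef.
Definition Snr := quartic Snr_coef.

(** normal form statement for generator S and normal form Hbar *)
Definition normal_form (S Hbar : 'rV[R]_4 -> R[i]) : Prop :=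
  (forall v, Gham v + pb S Nham v = Hbar v) /\
  exists r : R, 0 < r /\ exists C : R, exists Phi1 : 'rV[R]_4 -> 'rV[R]_4,
    (forall v w, nrm v < r -> nrm w < r -> Phi1 v = Phi1 w -> v = w) /\
    forall v, nrm v < r ->
      [/\ time_one S Phi1 v,
          symplectic_at Phi1 v,
          nrm (Phi1 v - v) <= C * nrm v ^+ 3 &
          cmod (Hham (Phi1 v) - Nham v - Hbar v) <= C * nrm v ^+ 6].

End Defs.

(* Main.v *)
(* Write X for the Hamiltonian vector field of the real quartic S. Monomials are
   eigenvectors of {., N}: {z^a zbar^b, N} = i w.(a - b) z^a zbar^b, so the
   homological equation G + {S, N} = Hbar reduces to w.(a - b) <> 0 on the removed
   monomials. Since X is a homogeneous cubic, it has a small Lipschitz constant near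
   the origin, so a Picard iteration reaches time 1; the variational equation
   J' = J DX is solved in the same way and its solution is the differential of the
   flow, which preserves the symplectic form because DX is a Hamiltonian matrix.
   Finally d/dt N(z(t)) = P(z(t)) with P = {S, N} a quartic, and z(t) = z + O(|z|^3),
   so N(z(1)) - N(z) - P(z) and G(z(1)) - G(z) are both O(|z|^6). *)

Require Import Defs.
From mathcomp Require Import all_boot all_order all_algebra.
From mathcomp Require Import complex.
From mathcomp Require Import all_classical all_reals all_analysis.
From mathcomp Require Import ring lra zify.
Import Order.TTheory GRing.Theory Num.Theory.
Import numFieldNormedType.Exports.
Local Open Scope ring_scope.
Set Implicit Arguments.
Unset Strict Implicit.

(** * Quadratic differentiability on the unit interval *)

(** No Banach space of curves is used: every estimate is an explicit inequality on [0, 1], endpoints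
    included. Picard iterates converge pointwise with an error c 2^-k, and [qd] passes to the limit
    because one constant serves all iterates; integration enters only through a scalar primitive.
    Existence is proved for matrix-valued curves and a time-dependent right-hand side, so that the
    flow (rows) and the variational equation (square matrices) are two instances of one theorem. The
    Lipschitz constant 1/2 near the origin is both the contraction rate and the factor absorbed in
    the Gronwall estimate. The generator is real because its coefficients satisfy S_{b,a} = conj
    S_{a,b}, which turns the complex problem into one about a real polynomial vector field on R^4.
    Polynomials are kept as coefficient tensors, so that Lipschitz bounds, Taylor remainders and the
    symmetry of second derivatives are inductions on the degree. *)

Section Quadratic.
Local Open Scope classical_set_scope.
Local Open Scope ring_scope.
Context {R : realType}.

Lemma mean_value_bound (f df : R -> R) (a b B : R) : a <= b ->
  (forall x, a < x < b -> is_derive x 1 f (df x)) ->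
  {within `[a, b], continuous f} ->
  (forall x, a <= x <= b -> `|df x| <= B) ->
  `|f b - f a| <= B * (b - a).
Proof.
move=> ab df' cf bnd.
have df'' x : x \in `]a, b[ -> is_derive x 1 f (df x).
  by rewrite in_itv/=; exact: df'.
have [c cab ->] := MVT_segment ab df'' cf.
rewrite normrM (ger0_norm (x := b - a)) ?subr_ge0//.
by rewrite ler_wpM2r ?subr_ge0// bnd//; move: cab; rewrite in_itv.
Qed.

Lemma lipschitz_within (V : normedModType R) (f : R -> V) (A : set R) (B : R) :
  (forall s t, A s -> A t -> `|f s - f t| <= B * `|s - t|) ->
  {within A, continuous f}.
Proof.
move=> fB; have B1 : 0 < `|B| + 1 by rewrite ltr_wpDl.
apply/subspace_continuousP => t At; apply/cvgrPdist_le => e e0.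
rewrite !near_withinE; near=> s => As.
rewrite (le_trans (fB _ _ At As))//.
apply: (@le_trans _ _ ((`|B| + 1) * `|t - s|)).
  by rewrite ler_wpM2r// (le_trans (ler_norm _))// lerDl.
rewrite -ler_pdivlMl// mulrC; near: s.
by apply: cvgr_dist_le => //; rewrite divr_gt0.
Unshelve. all: by end_near. Qed.

(* A quantitative derivative on [0, 1]: unlike differentiability, it survives
   pointwise limits. *)
Definition qd {V : normedModType R} (f g : R -> V) (K : R) : Prop :=
  forall s t : R, 0 <= s <= 1 -> 0 <= t <= 1 ->
  `|f s - f t - (s - t) *: g t| <= K * (s - t) ^+ 2.

Lemma qd_lipschitz (V : normedModType R) (f g : R -> V) (K B : R) : 0 <= K ->
  qd f g K -> (forall t : R, 0 <= t <= 1 -> `|g t| <= B) ->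
  forall s t : R, 0 <= s <= 1 -> 0 <= t <= 1 -> `|f s - f t| <= (K + B) * `|s - t|.
Proof.
move=> K0 fg gB s t s01 t01.
rewrite -(subrK ((s - t) *: g t) (f s - f t)) mulrDl.
rewrite (le_trans (ler_normD _ _))// lerD//.
  rewrite (le_trans (fg _ _ s01 t01))// ler_wpM2l// -real_normK ?num_real//.
  by rewrite expr2 ler_piMl// ler_norml; lra.
by rewrite normrZ mulrC ler_wpM2r// gB.
Qed.

Lemma qd_is_derive (V : normedModType R) (f g : R -> V) (K t : R) :
  qd f g K -> 0 < t < 1 -> is_derive t 1 f (g t).
Proof.
move=> fg t01.
suff : (fun h => h^-1 *: ((f \o shift t) (h *: 1) - f t)) @ 0^' --> g t.
  by move=> H; split; [apply/cvg_ex; exists (g t)|exact/cvg_lim].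
apply/cvgrPdist_le => e e0.
have K1 : 0 < `|K| + 1 by rewrite ltr_wpDl.
near=> h.
have h0 : h != 0 by near: h; exact: nbhs_dnbhs_neq.
have -> : g t - h^-1 *: ((f \o shift t) (h *: 1) - f t) =
   - (h^-1 *: (f (h + t) - f t - (h + t - t) *: g t)).
  rewrite /= addrK [X in X + t](_ : _ = h); last exact: mulr1.
  by rewrite [in RHS]scalerBr scalerA mulVf// scale1r opprB.
rewrite normrN normrZ.
have ht : 0 <= h + t <= 1.
  have : `|h| <= Num.min t (1 - t).
    near: h; apply: dnbhs0_le; rewrite lt_min; lra.
  by rewrite le_min !ler_norml; lra.
have t01' : 0 <= t <= 1 by lra.
have := fg _ _ ht t01'; rewrite addrK => H.
rewrite normfV ler_pdivrMl ?normr_gt0// (le_trans H)//.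
rewrite -real_normK ?num_real// expr2 mulrA mulrC ler_wpM2l//.
apply: (@le_trans _ _ ((`|K| + 1) * `|h|)).
  by rewrite ler_wpM2r// (le_trans (ler_norm _))// lerDl.
rewrite -ler_pdivlMl// mulrC; near: h; apply: dnbhs0_le.
by rewrite divr_gt0.
Unshelve. all: by end_near. Qed.

Lemma qd_continuous (V : normedModType R) (f g : R -> V) (K : R) : 0 <= K ->
  qd f g K -> {within `[0, 1], continuous f}.
Proof.
move=> K0 fg; apply/subspace_continuousP => t; rewrite /= in_itv/= => t01.
have B1 : 0 < K + `|g t| + 1 by rewrite ltr_wpDl// addr_ge0.
apply/cvgrPdist_le => e e0.
rewrite !near_withinE; near=> s; rewrite /= in_itv/= => s01.
rewrite distrC -(subrK ((s - t) *: g t) (f s - f t)).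
apply: (@le_trans _ _ ((K + `|g t| + 1) * `|t - s|)); last first.
  rewrite -ler_pdivlMl// mulrC; near: s.
  by apply: cvgr_dist_le => //; rewrite divr_gt0.
rewrite (distrC t) mulrDl mul1r -[leLHS]addr0 lerD//.
rewrite mulrDl (le_trans (ler_normD _ _))// lerD//.
  rewrite (le_trans (fg _ _ s01 t01))// ler_wpM2l// -real_normK ?num_real//.
  by rewrite expr2 ler_piMl// ler_norml; lra.
by rewrite normrZ mulrC.
Unshelve. all: by end_near. Qed.

Lemma mx_coord_le m n (A : 'M[R]_(m, n)) i j : `|A i j| <= `|A|.
Proof.
by rewrite [leRHS]/Num.Def.normr/= mx_normrE; exact: (le_bigmax _ _ (i, j)).
Qed.

Lemma mx_norm_le m n (A : 'M[R]_(m, n)) (B : R) : 0 <= B ->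
  (forall i j, `|A i j| <= B) -> `|A| <= B.
Proof.
move=> B0 AB; rewrite [leLHS]/Num.Def.normr/= mx_normrE.
by apply: bigmax_le => //= -[i j] _; exact: AB.
Qed.

Lemma mulmx_norm_le m n p (A : 'M[R]_(m, n)) (B : 'M[R]_(n, p)) :
  `|A *m B| <= n%:R * (`|A| * `|B|).
Proof.
apply: mx_norm_le => [|i j]; first by rewrite !mulr_ge0.
rewrite mxE (le_trans (ler_norm_sum _ _ _))//.
apply: (@le_trans _ _ (\sum_(k < n) `|A| * `|B|)).
  by apply: ler_sum => k _; rewrite normrM ler_pM// mx_coord_le.
by rewrite sumr_const card_ord mulr_natl.
Qed.

Lemma qd_coord m n (f g : R -> 'M[R]_(m, n)) (K : R) i j : qd f g K ->
  qd (fun t => f t i j) (fun t => g t i j) K.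
Proof.
move=> fg s t s01 t01; apply: le_trans (fg s t s01 t01).
by apply: le_trans (mx_coord_le _ i j); rewrite !mxE.
Qed.

Lemma subrACA (V : zmodType) (a b c d : V) : a - b - (c - d) = a - c - (b - d).
Proof. by rewrite !opprD !opprK addrACA. Qed.

Lemma qdB (V : normedModType R) (f1 f2 g1 g2 : R -> V) (K1 K2 : R) :
  qd f1 g1 K1 -> qd f2 g2 K2 ->
  qd (fun t => f1 t - f2 t) (fun t => g1 t - g2 t) (K1 + K2).
Proof.
move=> q1 q2 s t s01 t01; rewrite mulrDl.
have -> : f1 s - f2 s - (f1 t - f2 t) - (s - t) *: (g1 t - g2 t) =
  (f1 s - f1 t - (s - t) *: g1 t) - (f2 s - f2 t - (s - t) *: g2 t).
  by rewrite scalerBr; rewrite (subrACA (f1 s)) (subrACA (f1 s - f1 t)).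
by rewrite (le_trans (ler_normB _ _))// lerD ?q1 ?q2.
Qed.

Lemma qd_mulmx m n p (h : 'M[R]_(m, n)) (f g : R -> 'M[R]_(n, p)) (K : R) :
  qd f g K ->
  qd (fun t => h *m f t) (fun t => h *m g t) (n%:R * (`|h| * K)).
Proof.
move=> q s t s01 t01; rewrite scalemxAr -!mulmxBr (le_trans (mulmx_norm_le _ _))//.
by rewrite -2!mulrA ler_wpM2l// ler_wpM2l// q.
Qed.

(** The mean value theorem is scalar; since the norm of a matrix is the maximum of its entries,
    working entry by entry costs no constant. *)
Lemma qd_bound m n (f g : R -> 'M[R]_(m, n)) (K B a b : R) : 0 <= K ->
  qd f g K -> 0 <= a -> a <= b -> b <= 1 -> 0 <= B ->
  (forall t : R, a <= t <= b -> `|g t| <= B) ->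
  `|f b - f a| <= B * (b - a).
Proof.
move=> K0 fg a0 ab b1 B0 gB; apply: mx_norm_le => [|i j].
  by rewrite mulr_ge0// subr_ge0.
rewrite !mxE; apply: (@mean_value_bound (fun t => f t i j) (fun t => g t i j)) => //.
- by move=> x xab; apply: (@qd_is_derive _ _ (fun t => g t i j) K x (qd_coord i j fg)); lra.
- apply: continuous_subspaceW (qd_continuous K0 (qd_coord i j fg)).
  by move=> x /=; rewrite !in_itv/=; lra.
- by move=> x xab; rewrite (le_trans (mx_coord_le _ _ _))// gB.
Qed.

(* With M = sup |f|, the mean value inequality gives M <= M / 2 + B. *)
Lemma qd_gronwall m n (f g : R -> 'M[R]_(m, n)) (K B t0 : R) : 0 <= K ->
  qd f g K -> 0 <= t0 <= 1 -> f t0 = 0 -> 0 <= B ->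
  (forall t : R, 0 <= t <= 1 -> `|g t| <= 2^-1 * `|f t| + B) ->
  forall t : R, 0 <= t <= 1 -> `|f t| <= 2 * B.
Proof.
move=> K0 fg t01 ft0 B0 gB.
have cf : {within `[0, 1], continuous (fun t => `|f t|)}.
  by move=> t; apply: continuous_comp;
    [exact: (qd_continuous K0 fg)|exact: norm_continuous].
have [c c01 cmax] := EVT_max ler01 cf; move: c01; rewrite in_itv/= => c01.
have gM (t : R) : 0 <= t <= 1 -> `|g t| <= 2^-1 * `|f c| + B.
  move=> t1; rewrite (le_trans (gB _ t1))// lerD2r ler_wpM2l//.
  by apply: cmax; rewrite in_itv.
have M0 : 0 <= 2^-1 * `|f c| + B by rewrite addr_ge0// mulr_ge0.
have fc : `|f c| <= 2^-1 * `|f c| + B.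
  apply: (@le_trans _ _ ((2^-1 * `|f c| + B) * `|c - t0|)); last first.
    by rewrite ler_piMr// ler_norml; lra.
  rewrite -[f c in leLHS]subr0 -ft0; have [ct|tc] := leP c t0.
    rewrite distrC (distrC c) (ger0_norm (x := t0 - c)) ?subr_ge0//.
    apply: (@qd_bound _ _ f g K _ c t0 K0 fg _ ct _ M0) => //;
      [lra|lra|move=> t tc; apply: gM; lra].
  rewrite (ger0_norm (x := c - t0)) ?subr_ge0 ?(ltW tc)//.
  apply: (@qd_bound _ _ f g K _ t0 c K0 fg _ (ltW tc) _ M0) => //;
    [lra|lra|move=> t tc'; apply: gM; lra].
move=> t t1; have /cmax : t \in `[0, 1]%R by rewrite in_itv.
by move=> /le_trans; apply; lra.
Qed.

Lemma primitive_exists (g : R -> R) : {within `[0, 1], continuous g} ->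
  exists G : R -> R, [/\ G 0 = 0, {within `[0, 1], continuous G} &
    forall t : R, 0 < t < 1 -> is_derive t 1 G (g t)].
Proof.
move=> cg.
have ig : (@lebesgue_measure R).-integrable `[0, 1] (EFin \o g).
  exact: continuous_compact_integrable (@segment_compact _ _ _) cg.
exists (fun x => parameterized_integral (@lebesgue_measure R) 0 x g); split.
- by rewrite /parameterized_integral set_itv1 Rintegral_set1.
- exact: parameterized_integral_continuous ler01 ig.
- move=> t t01; have [t0 t1] := andP t01.
  have ct : {for t, continuous g}.
    by apply: (within_continuous_continuous _ cg) => //; rewrite in_itv/= t01.
  have [d1 d2] := continuous_FTC1_closed t1 ig t0 ct.
  by apply: DeriveDef; [exact: d1|rewrite -derive1E; exact: d2].
Qed.

End Quadratic.

(** * Local existence for ordinary differential equations *)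

Section Picard.
Context {R : realType}.

(** How estimates pass to the limit of the iterates: it suffices to prove them with an error c 2^-k
    for every k. *)
Lemma le_geometric (a b c : R) : (forall k, a <= b + c * 2^-1 ^+ k) -> a <= b.
Proof.
move=> abc; apply/ler_addgt0Pr => e e0.
have c0 : 0 <= `|c| / e by rewrite divr_ge0// ltW.
have [k kc] : exists k, `|c| / e < k%:R.
  by exists (Num.bound (`|c| / e)); exact: archi_boundP.
apply: le_trans (abc k) _; rewrite lerD2l.
have k2 : (k%:R : R) <= 2 ^+ k by rewrite -natrX ler_nat ltnW// ltn_expl.
apply: (@le_trans _ _ (`|c| * 2^-1 ^+ k)).
  by rewrite ler_wpM2r ?exprn_ge0 ?invr_ge0// ler_norm.
rewrite exprVn ler_pdivrMr ?exprn_gt0// mulrC -ler_pdivrMr//.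
by rewrite (le_trans (ltW kc)).
Qed.

(** Nested intervals: the radius 2 c 2^-k around [u k] shrinks by c 2^-k at each step, which is
    exactly the allowed move of the centre. The supremum of the lower ends therefore lies in all the
    intervals. *)
Lemma geometric_limit (u : nat -> R) (c : R) : 0 <= c ->
  (forall k, `|u k.+1 - u k| <= c * 2^-1 ^+ k) ->
  exists l, forall k, `|l - u k| <= 2 * c * 2^-1 ^+ k.
Proof.
move=> c0 uc.
pose w k := u k - 2 * c * 2^-1 ^+ k; pose x k := u k + 2 * c * 2^-1 ^+ k.
have w_nd : {homo w : i j / (i <= j)%N >-> i <= j}.
  apply: homo_leq => [//|y z t|k]; first exact: le_trans.
  by have := uc k; rewrite /w exprS ler_norml; lra.
have x_ni : {homo x : i j / (i <= j)%N >-> i >= j}.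
  apply: (@homo_leq _ x (fun a b => b <= a)) => [//|y z t zy yt|k].
    exact: le_trans yt zy.
  by have := uc k; rewrite /x exprS ler_norml; lra.
have wx i j : w i <= x j.
  apply: le_trans (w_nd _ _ (leq_maxl i j)) _.
  apply: le_trans (x_ni _ _ (leq_maxr i j)).
  have p : 0 <= 2^-1 ^+ maxn i j :> R by rewrite exprn_ge0// invr_ge0.
  by rewrite /w /x; rewrite lerD2l (@le_trans _ _ 0)// ?oppr_le0 ?mulr_ge0.
have hs : has_sup [set w k | k in setT]%classic.
  split; first by exists (w 0%N); exists 0%N.
  by exists (x 0%N) => _ [k _ <-].
exists (sup [set w k | k in setT]%classic) => k.
have h1 : w k <= sup [set w k | k in setT]%classic.
  by apply: sup_upper_bound => //; exists k.
have h2 : sup [set w k | k in setT]%classic <= x k.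
  by apply: ge_sup; [exact: hs.1|move=> _ [j _ <-]].
by move: h1 h2; rewrite /w /x ler_norml; lra.
Qed.

Lemma geometric_limit_mx m n (u : nat -> 'M[R]_(m, n)) (c : R) : 0 <= c ->
  (forall k, `|u k.+1 - u k| <= c * 2^-1 ^+ k) ->
  exists l, forall k, `|l - u k| <= 2 * c * 2^-1 ^+ k.
Proof.
move=> c0 uc.
have /choice[l lP] : forall ij : 'I_m * 'I_n, exists l,
    forall k, `|l - u k ij.1 ij.2| <= 2 * c * 2^-1 ^+ k.
  move=> [i j]; apply: geometric_limit => // k /=; apply: le_trans (uc k).
  by apply: le_trans (mx_coord_le _ i j); rewrite !mxE.
exists (\matrix_(i, j) l (i, j)) => k; apply: mx_norm_le => [|i j].
  by rewrite !mulr_ge0// exprn_ge0// invr_ge0.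
by rewrite !mxE; exact: (lP (i, j)).
Qed.

Lemma primitive_mx m n (g : R -> 'M[R]_(m, n)) (L B : R) : 0 <= L -> 0 <= B ->
  (forall s t : R, 0 <= s <= 1 -> 0 <= t <= 1 -> `|g s - g t| <= L * `|s - t|) ->
  (forall t : R, 0 <= t <= 1 -> `|g t| <= B) ->
  exists G : R -> 'M[R]_(m, n), [/\ G 0 = 0, qd G g L &
    forall s t : R, 0 <= s <= 1 -> 0 <= t <= 1 -> `|G s - G t| <= B * `|s - t|].
Proof.
move=> L0 B0 gL gB.
have gLij (s t : R) i j : 0 <= s <= 1 -> 0 <= t <= 1 -> `|g s i j - g t i j| <= L * `|s - t|.
  move=> s01 t01; apply: le_trans (gL _ _ s01 t01).
  by apply: le_trans (mx_coord_le _ i j); rewrite !mxE.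
have /choice[G GP] : forall ij : 'I_m * 'I_n, exists G : R -> R,
    [/\ G 0 = 0, {within `[0, 1], continuous G}%classic &
    forall t : R, 0 < t < 1 -> is_derive t 1 G (g t ij.1 ij.2)].
  move=> [i j]; apply: primitive_exists; apply: (@lipschitz_within _ _ _ _ L) => s t.
  by rewrite /= !in_itv/=; exact: gLij.
(* One mean value estimate for G - c x serves twice: c = [g t i j] gives the quadratic remainder, c
   = 0 the Lipschitz bound. *)
have incr i j (s t c A : R) : 0 <= t -> t <= s -> s <= 1 ->
    (forall x : R, t <= x <= s -> `|g x i j - c| <= A) ->
    `|G (i, j) s - G (i, j) t - (s - t) * c| <= A * (s - t).
  move=> t0 ts s1 gA; have [_ cG dG] := GP (i, j).
  have := @mean_value_bound _ (fun x => G (i, j) x - x * c) (fun x => g x i j - c) t s A ts.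
  have -> : G (i, j) s - s * c - (G (i, j) t - t * c) =
     G (i, j) s - G (i, j) t - (s - t) * c by ring.
  apply => //.
    move=> x xts; have x01 : 0 < x < 1 by lra.
    have d1 := dG _ x01; rewrite /= in d1.
    have d2 : is_derive x 1 (fun y : R => y * c) c.
      by apply: is_derive_eq; rewrite scaler0 add0r /GRing.scale/= mulr1.
    exact: is_deriveB d1 d2.
  have cc : {within `[t, s], continuous (fun y : R => y * c)}%classic.
    by apply: (@lipschitz_within _ _ _ _ `|c|) => y z _ _; rewrite -mulrBl normrM mulrC.
  move=> x; apply: cvgB; last exact: cc.
  apply: (continuous_subspaceW _ cG) => y /=; rewrite !in_itv/=; lra.
exists (fun t => \matrix_(i, j) G (i, j) t); split.
- by apply/matrixP => i j; rewrite !mxE; have [] := GP (i, j).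
- move=> s t s01 t01; apply: mx_norm_le => [|i j].
    by rewrite mulr_ge0// sqr_ge0.
  rewrite !mxE.
  have [ts|/ltW st] := leP t s.
    have -> : L * (s - t) ^+ 2 = L * (s - t) * (s - t) by ring.
    apply: incr => //; [lra|lra|move=> x xts].
    rewrite (le_trans (gLij _ _ _ _ _ _))//; first lra.
    by rewrite ler_wpM2l// ger0_norm ?subr_ge0; lra.
  have -> : L * (s - t) ^+ 2 = L * (t - s) * (t - s) by ring.
  (* When s precedes t the slope is still the value at t, now the right end of the interval. *)
  have := @incr i j t s (g t i j) (L * (t - s)) _ st _ _.
  rewrite -normrN => H; apply: le_trans (H _ _ _); [|lra|lra|].
    by rewrite le_eqVlt; apply/orP; left; apply/eqP; congr `|_|; ring.
  move=> x xts; rewrite (le_trans (gLij _ _ _ _ _ _))//; first lra.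
  by rewrite ler_wpM2l// ler0_norm ?subr_le0; lra.
- move=> s t s01 t01; apply: mx_norm_le => [|i j]; first by rewrite mulr_ge0.
  rewrite !mxE; wlog ts : s t s01 t01 / t <= s => [H|].
    have [|/ltW] := leP t s; first exact: H.
    by rewrite distrC (distrC s); exact: H.
  rewrite (ger0_norm (x := s - t)) ?subr_ge0//.
  have := @incr i j s t 0 B; rewrite mulr0 subr0; apply => //; [lra|lra|].
  move=> x xts; rewrite subr0 (le_trans (mx_coord_le _ _ _))// gB//; lra.
Qed.

(** On the ball of radius [|v|] about v, which lies in the ball of radius 2 |v| <= rho about 0, F t
    0 = 0 and the Lipschitz constant 1/2 give |F| <= |v|. A curve of that speed stays in the ball up
    to time 1. *)
Theorem picard m n (F : R -> 'M[R]_(m, n) -> 'M[R]_(m, n)) (rho K : R) (v : 'M[R]_(m, n)) :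
  0 <= K ->
  (forall (t : R) x y, 0 <= t <= 1 -> `|x| <= rho -> `|y| <= rho ->
     `|F t x - F t y| <= 2^-1 * `|x - y|) ->
  (forall (s t : R) x, 0 <= s <= 1 -> 0 <= t <= 1 -> `|x| <= rho ->
     `|F s x - F t x| <= K * `|s - t|) ->
  (forall t : R, 0 <= t <= 1 -> F t 0 = 0) ->
  2 * `|v| <= rho ->
  exists gam : R -> 'M[R]_(m, n), [/\ gam 0 = v,
    forall t : R, 0 <= t <= 1 -> `|gam t - v| <= `|v| &
    qd gam (fun t => F t (gam t)) (K + `|v|)].
Proof.
move=> K0 Fx Ft F0 vrho.
have v0 : 0 <= `|v| by [].
have inrho (x : 'M[R]_(m, n)) : `|x - v| <= `|v| -> `|x| <= rho /\ `|x| <= 2 * `|v|.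
  by move=> xv; have := ler_normD (x - v) v; rewrite subrK; lra.
have FB (t : R) x : 0 <= t <= 1 -> `|x - v| <= `|v| -> `|F t x| <= `|v|.
  move=> t01 /inrho[xr x2]; have r0 : `|0 : 'M[R]_(m, n)| <= rho by rewrite normr0; lra.
  by have := Fx t x 0 t01 xr r0; rewrite F0// !subr0; lra.
(* The Lipschitz clause makes F t (gam t) Lipschitz in t, with a constant that does not grow along
   the iteration. *)
pose Inv (gam : R -> 'M[R]_(m, n)) :=
  (forall t : R, 0 <= t <= 1 -> `|gam t - v| <= `|v|) /\
  (forall s t : R, 0 <= s <= 1 -> 0 <= t <= 1 -> `|gam s - gam t| <= `|v| * `|s - t|).
(* Curves that violate [Inv] are mapped to themselves, only to make [step] total. *)
have /choice[step stepP] : forall gam, exists gam', Inv gam ->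
    [/\ Inv gam', gam' 0 = v & qd gam' (fun t => F t (gam t)) (K + `|v|)].
  move=> gam; have [Igam|nI] := pselect (Inv gam); last by exists gam.
  have [gv gl] := Igam.
  have [||s t s01 t01|t t01|G [G0 qG lG]] :=
      @primitive_mx m n (fun t => F t (gam t)) (K + `|v|) `|v|.
  - by rewrite addr_ge0.
  - by [].
  - rewrite -(subrKA (F t (gam s))) mulrDl (le_trans (ler_normD _ _))// lerD//.
      by apply: Ft => //; exact: (inrho _ (gv _ s01)).1.
    apply: le_trans (Fx _ _ _ t01 _ _) _;
      [exact: (inrho _ (gv _ s01)).1|exact: (inrho _ (gv _ t01)).1|].
    by have := gl _ _ s01 t01; have : 0 <= `|gam s - gam t| by []; lra.
  - exact: FB (gv _ t01).
  exists (fun t => v + G t) => _; split; last 2 first.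
  - by rewrite G0 addr0.
  - move=> s t s01 t01; rewrite opprD addrACA subrr add0r; exact: qG.
  split=> [t t01|s t s01 t01]; last by rewrite opprD addrACA subrr add0r; exact: lG.
  have z01 : 0 <= (0 : R) <= 1 by rewrite lexx ler01.
  have := lG t 0 t01 z01; rewrite G0 !subr0 addrC addKr => /le_trans; apply.
  by rewrite ler_piMr// ler_norml; lra.
pose gk k := iter k step (fun=> v).
have Igk k : Inv (gk k).
  elim: k => [|k /stepP[]//]; split=> /= *; rewrite subrr normr0 ?mulr_ge0//.
have qk k : qd (gk k.+1) (fun t => F t (gk k t)) (K + `|v|).
  by have [] := stepP _ (Igk k).
have gk0 k : gk k 0 = v by case: k => // k; have [] := stepP _ (Igk k).
have gkS k (t : R) : 0 <= t <= 1 -> `|gk k.+1 t - gk k t| <= `|v| * 2^-1 ^+ k.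
  elim: k t => [|k IH] t t01.
    by rewrite expr0 mulr1; exact: (Igk 1%N).1.
  have c0 : 0 <= `|v| * 2^-1 ^+ k.+1 by rewrite mulr_ge0// exprn_ge0// invr_ge0.
  have KK : 0 <= K + `|v| + (K + `|v|) by rewrite !addr_ge0.
  have := @qd_bound _ _ _ _ _ _ (`|v| * 2^-1 ^+ k.+1) 0 t KK (qdB (qk k.+1) (qk k)).
  have e0 : gk k.+2 0 - gk k.+1 0 = 0 by rewrite !gk0 subrr.
  move=> H; rewrite -[X in `|X|]subr0 -e0.
  apply: le_trans (H _ _ _ _ _) _ => //; [lra|lra| |].
    move=> s st; have s01 : 0 <= s <= 1 by lra.
    have := Fx s (gk k.+1 s) (gk k s) s01 (inrho _ ((Igk k.+1).1 _ s01)).1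
      (inrho _ ((Igk k).1 _ s01)).1.
    by have := IH s s01; rewrite exprS; lra.
  by rewrite subr0 ler_piMr//; lra.
have /choice[gam gamP] : forall t : R, exists l, 0 <= t <= 1 ->
    forall k, `|l - gk k t| <= 2 * `|v| * 2^-1 ^+ k.
  move=> t; have [t01|/negP nt] := boolP (0 <= t <= 1); last by exists 0.
  by have [l lP] := geometric_limit_mx v0 (gkS^~ t ^~ t01); exists l.
have gamv (t : R) : 0 <= t <= 1 -> `|gam t - v| <= `|v|.
  move=> t01; apply: (@le_geometric _ _ (2 * `|v|)) => k.
  rewrite -(subrKA (gk k t)) addrC (le_trans (ler_normD _ _))// lerD//.
    exact: (Igk k).1.
  exact: gamP.
exists gam; split => //.
  apply/eqP; rewrite -subr_eq0 -normr_le0; apply: (@le_geometric _ _ (2 * `|v|)) => k.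
  by rewrite add0r -[v in leLHS](gk0 k); apply: gamP; rewrite lexx ler01.
(* The factor 3: replacing gam by the iterate k+1 at s and at t costs 2 |v| 2^-(k+1) each, and
   replacing gam by the iterate k inside F costs half of 2 |v| 2^-k. *)
move=> s t s01 t01; apply: (@le_geometric _ _ (3 * `|v|)) => k.
have e1 := gamP s s01 k.+1; have e2 := gamP t t01 k.+1.
have e3 := Fx t (gam t) (gk k t) t01 (inrho _ (gamv _ t01)).1
  (inrho _ ((Igk k).1 _ t01)).1.
have e4 := gamP t t01 k; have e5 := qk k s t s01 t01.
have -> : gam s - gam t - (s - t) *: F t (gam t) =
  (gk k.+1 s - gk k.+1 t - (s - t) *: F t (gk k t)) +
  ((gam s - gk k.+1 s) - (gam t - gk k.+1 t)
    - (s - t) *: (F t (gam t) - F t (gk k t))).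
  by rewrite scalerBr; apply/matrixP => i j; rewrite !mxE; ring.
have st1 : `|s - t| <= 1 by rewrite ler_norml; lra.
have e6 : `|(s - t) *: (F t (gam t) - F t (gk k t))| <= `|F t (gam t) - F t (gk k t)|.
  by rewrite normrZ ler_piMl.
rewrite (le_trans (ler_normD _ _))// lerD//.
apply: le_trans (ler_normB _ _) _; apply: le_trans (lerD (ler_normB _ _) (lexx _)) _.
by move: e1 e2; rewrite exprS; lra.
Qed.

End Picard.

(** * Homogeneous polynomials *)

Section HomogeneousPolynomials.
Context {R : realType} {n : nat}.

(* Homogeneous polynomials of degree d in n variables are represented by
   (not necessarily symmetric) coefficient tensors. *)
Fixpoint tens (d : nat) : Type := if d is d'.+1 then 'I_n -> tens d' else R.

Definition slice d (T : tens d.+1) (i : 'I_n) : tens d := T i.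

Fixpoint ev d : tens d -> 'rV[R]_n -> R :=
  match d with
  | 0 => fun c _ => c
  | d'.+1 => fun T v => \sum_(i < n) v ord0 i * ev (slice T i) v
  end.

Fixpoint dv d : tens d -> 'rV[R]_n -> 'rV[R]_n -> R :=
  match d with
  | 0 => fun _ _ _ => 0
  | d'.+1 => fun T v h =>
      \sum_(i < n) (h ord0 i * ev (slice T i) v + v ord0 i * dv (slice T i) v h)
  end.

Fixpoint tadd d : tens d -> tens d -> tens d :=
  match d with
  | 0 => fun a b => a + b
  | d'.+1 => fun S T i => tadd (slice S i) (slice T i)
  end.

Fixpoint tscale (c : R) d : tens d -> tens d :=
  match d with
  | 0 => fun a => c * a
  | d'.+1 => fun T i => tscale c (slice T i)
  end.

(** Product rule for the sum of the v_i T_i(v): differentiating v_i leaves the slice at k,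
    differentiating the T_i leaves their partial derivatives. The result is again a tensor, so [pd]
    can be iterated. *)
Fixpoint pd (k : 'I_n) d : tens d.+1 -> tens d :=
  match d with
  | 0 => fun T => slice T k
  | d'.+1 => fun T => @tadd d'.+1 (slice T k) (fun i => @pd k d' (slice T i))
  end.

Fixpoint tnorm d : tens d -> R :=
  match d with
  | 0 => fun c => `|c|
  | d'.+1 => fun T => \sum_(i < n) tnorm (slice T i)
  end.

Lemma ev_tadd d (S T : tens d) v : ev (tadd S T) v = ev S v + ev T v.
Proof.
elim: d S T => [//|d IH] S T /=; rewrite -big_split/=; apply: eq_bigr => i _.
by rewrite IH mulrDr.
Qed.

Lemma ev_tscale c d (T : tens d) v : ev (tscale c T) v = c * ev T v.
Proof.
elim: d T => [//|d IH] T /=; rewrite mulr_sumr; apply: eq_bigr => i _.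
by rewrite IH mulrCA.
Qed.

Lemma tnorm_ge0 d (T : tens d) : 0 <= tnorm T.
Proof. by elim: d T => [|d IH] T /=; [|apply: sumr_ge0]. Qed.

Lemma ev_bound d (T : tens d) v (r : R) : `|v| <= r -> `|ev T v| <= tnorm T * r ^+ d.
Proof.
move=> vr; have r0 : 0 <= r by exact: le_trans vr.
elim: d T => [|d IH] T /=; first by rewrite expr0 mulr1.
rewrite (le_trans (ler_norm_sum _ _ _))// mulr_suml; apply: ler_sum => i _.
by rewrite normrM exprS mulrCA ler_pM// (le_trans (mx_coord_le _ _ _)).
Qed.

Lemma ev_lipschitz d (T : tens d) x y (r : R) : `|x| <= r -> `|y| <= r ->
  `|ev T x - ev T y| <= d%:R * tnorm T * r ^+ d.-1 * `|x - y|.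
Proof.
move=> xr yr; have r0 : 0 <= r by exact: le_trans xr.
elim: d T => [|d IH] T /=; first by rewrite subrr normr0 !mul0r.
rewrite -sumrB (le_trans (ler_norm_sum _ _ _))// mulr_sumr !mulr_suml.
apply: ler_sum => i _.
have -> : x ord0 i * ev (slice T i) x - y ord0 i * ev (slice T i) y =
  (x - y) ord0 i * ev (slice T i) x + y ord0 i * (ev (slice T i) x - ev (slice T i) y).
  by rewrite !mxE; ring.
rewrite (le_trans (ler_normD _ _))// !normrM.
have -> : d.+1%:R * tnorm (slice T i) * r ^+ d * `|x - y| =
  `|x - y| * (tnorm (slice T i) * r ^+ d) + d%:R * tnorm (slice T i) * r ^+ d * `|x - y|.
  by rewrite -natr1; ring.
apply: lerD; first by rewrite ler_pM// ?mx_coord_le// ev_bound.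
apply: le_trans (ler_pM _ _ (le_trans (mx_coord_le _ _ _) yr) (IH _)) _ => //.
(* The truncated exponent [d.-1] is harmless at d = 0, where the factor [d%:R] vanishes. *)
case: d {IH} T => [|d] T; first by rewrite !mul0r mulr0.
by rewrite [in leRHS]exprS /= le_eqVlt; apply/orP; left; apply/eqP; ring.
Qed.

(** The remainder of x_i T_i is x_i times the remainder of T_i plus h_i times the increment of T_i.
    These contribute d^2 and d, and d^2 + d <= (d + 1)^2. *)
Lemma ev_taylor d (T : tens d) x h : `|x| <= 1 -> `|x + h| <= 1 ->
  `|ev T (x + h) - ev T x - dv T x h| <= (d ^ 2)%:R * tnorm T * `|h| ^+ 2.
Proof.
move=> x1 xh1; elim: d T => [|d IH] T /=.
  by rewrite subrr subr0 normr0 !mul0r.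
rewrite -!sumrB (le_trans (ler_norm_sum _ _ _))// mulr_sumr !mulr_suml.
apply: ler_sum => i _.
have -> : (x + h) ord0 i * ev (slice T i) (x + h) - x ord0 i * ev (slice T i) x
    - (h ord0 i * ev (slice T i) x + x ord0 i * dv (slice T i) x h) =
  x ord0 i * (ev (slice T i) (x + h) - ev (slice T i) x - dv (slice T i) x h)
  + h ord0 i * (ev (slice T i) (x + h) - ev (slice T i) x).
  by rewrite !mxE; ring.
rewrite (le_trans (ler_normD _ _))// !normrM.
have h1 : `|x ord0 i| * `|ev (slice T i) (x + h) - ev (slice T i) x - dv (slice T i) x h| <=
    (d ^ 2)%:R * tnorm (slice T i) * `|h| ^+ 2.
  by rewrite (le_trans _ (IH _))// ler_piMl// (le_trans (mx_coord_le _ _ _)).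
have h2 : `|h ord0 i| * `|ev (slice T i) (x + h) - ev (slice T i) x| <=
    d%:R * tnorm (slice T i) * `|h| ^+ 2.
  have := ev_lipschitz (slice T i) xh1 x1; rewrite expr1n mulr1 (addrC x) addrK => H.
  rewrite (le_trans (ler_pM _ _ (mx_coord_le _ _ _) H))//.
  by rewrite le_eqVlt; apply/orP; left; apply/eqP; ring.
apply: le_trans (lerD h1 h2) _; rewrite -!mulrDl -!mulrA ler_wpM2r//.
  by rewrite mulr_ge0// ?tnorm_ge0// sqr_ge0.
by rewrite -natrD ler_nat; lia.
Qed.

Lemma pdS k d (T : tens d.+2) :
  pd k T = tadd (slice T k) ((fun i => pd k (slice T i)) : tens d.+1).
Proof. by []. Qed.

Lemma dvS d (T : tens d.+1) v h :
  dv T v h = \sum_(i < n) (h ord0 i * ev (slice T i) v + v ord0 i * dv (slice T i) v h).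
Proof. by []. Qed.

Lemma dv_pd d (T : tens d.+1) v h :
  dv T v h = \sum_(k < n) h ord0 k * ev (pd k T) v.
Proof.
elim: d T => [|d IH] T.
  by apply: eq_bigr => i _ /=; rewrite mulr0 addr0.
have e : \sum_(i < n) v ord0 i * dv (slice T i) v h =
    \sum_(k < n) h ord0 k * \sum_(i < n) v ord0 i * ev (pd k (slice T i)) v.
  under eq_bigr do rewrite IH mulr_sumr.
  rewrite exchange_big; apply: eq_bigr => k _; rewrite mulr_sumr.
  by apply: eq_bigr => i _; exact: mulrCA.
rewrite dvS big_split e -big_split; apply: eq_bigr => k _.
by rewrite pdS ev_tadd mulrDr.
Qed.

(** Tensors need not be symmetric, so this is not immediate. Two product rules give [pd a T_b] +
    [pd b T_a] plus the mixed partials of the slices: the first two terms swap, the rest is the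
    induction hypothesis. *)
Lemma pdC d (T : tens d.+2) k l v : ev (pd k (pd l T)) v = ev (pd l (pd k T)) v.
Proof.
elim: d T => [|d IH] T; first by rewrite /= /slice /= addrC.
have E a (S1 S2 : tens d.+2) : ev (pd a (tadd S1 S2)) v =
    ev (pd a S1) v + ev (pd a S2) v.
  elim: (d.+1) S1 S2 => [|e IHe] S1 S2; first by [].
  rewrite [pd a (tadd S1 S2)]/= [pd a S1]/= [pd a S2]/= !ev_tadd.
  rewrite [in RHS]addrACA; congr (_ + _); rewrite /= -big_split.
  by apply: eq_bigr => i _ /=; rewrite IHe mulrDr.
have P a b : ev (pd a ((fun i => pd b (slice T i)) : tens d.+2)) v =
    ev (pd b (slice T a)) v + \sum_(i < n) v ord0 i * ev (pd a (pd b (slice T i))) v.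
  by rewrite pdS ev_tadd.
have Q a b : ev (pd a (pd b T)) v = ev (pd a (slice T b)) v +
    (ev (pd b (slice T a)) v + \sum_(i < n) v ord0 i * ev (pd a (pd b (slice T i))) v).
  exact: etrans (E _ _ _) (congr1 _ (P a b)).
rewrite !Q !addrA; congr (_ + _); first exact: addrC.
by apply: eq_bigr => i _; rewrite IH.
Qed.

Lemma is_derive_ev (W : normedModType R) (g : W -> 'rV[R]_n) (w u : W) (h : 'rV[R]_n) :
  (forall i, is_derive w u (fun x => g x ord0 i) (h ord0 i)) ->
  forall d (T : tens d), is_derive w u (fun x => ev T (g x)) (dv T (g w) h).
Proof.
move=> gh; elim=> [|d IH] T /=; first exact: is_derive_cst.
have -> : (fun x : W => \sum_(i < n) g x ord0 i * ev (slice T i) (g x)) =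
  \sum_(i < n) ((fun x => g x ord0 i) * (fun x => ev (slice T i) (g x))).
  by apply/funext => x; rewrite fct_sumE.
apply: is_derive_eq => //.
apply: eq_bigr => i _; rewrite addrC /GRing.scale/=; congr (_ + _).
exact: mulrC.
Qed.

(** * Functions given by real or complex homogeneous polynomials *)

Definition hpoly d (F : 'rV[R]_n -> R) := exists T : tens d, forall v, F v = ev T v.

Lemma hpolyD d F G : hpoly d F -> hpoly d G -> hpoly d (fun v => F v + G v).
Proof. by move=> [S FS] [T GT]; exists (tadd S T) => v; rewrite ev_tadd FS GT. Qed.

Lemma hpolyZ d c F : hpoly d F -> hpoly d (fun v => c * F v).
Proof. by move=> [T FT]; exists (tscale c T) => v; rewrite ev_tscale FT. Qed.

Lemma hpoly_ext d F G : F =1 G -> hpoly d F -> hpoly d G.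
Proof. by move=> FG [T FT]; exists T => v; rewrite -FG. Qed.

Lemma hpolyB d F G : hpoly d F -> hpoly d G -> hpoly d (fun v => F v - G v).
Proof.
move=> hF hG; apply: hpoly_ext (hpolyD hF (hpolyZ (-1) hG)) => v.
by rewrite mulN1r.
Qed.

Lemma hpolyC c : hpoly 0 (fun=> c).
Proof. by exists c. Qed.

Lemma hpoly0 d : hpoly d (fun=> 0).
Proof.
elim: d => [|d [T FT]]; first exact: hpolyC.
by exists (fun=> T) => v /=; rewrite big1// => i _; rewrite -FT mulr0.
Qed.

Lemma hpoly_sum d m (F : 'I_m -> 'rV[R]_n -> R) : (forall i, hpoly d (F i)) ->
  hpoly d (fun v => \sum_(i < m) F i v).
Proof.
elim: m F => [|m IH] F hF.
  by apply: hpoly_ext (hpoly0 d) => v; rewrite big_ord0.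
apply: hpoly_ext (hpolyD (hF ord0) (IH _ (fun i => hF (lift ord0 i)))) => v.
by rewrite big_ord_recl.
Qed.

Lemma hpoly_coordM d i F : hpoly d F -> hpoly d.+1 (fun v => v ord0 i * F v).
Proof.
move=> [T FT]; exists (fun j => tscale (i == j)%:R T) => v /=.
under eq_bigr do rewrite ev_tscale.
rewrite (bigD1 i)//= eqxx mul1r big1 ?addr0 ?FT// => j ji.
by rewrite eq_sym (negbTE ji) mul0r mulr0.
Qed.

Lemma hpoly_coord i : hpoly 1 (fun v => v ord0 i).
Proof.
by apply: hpoly_ext (hpoly_coordM i (hpolyC 1)) => v; rewrite mulr1.
Qed.

Lemma hpolyM a b F G : hpoly a F -> hpoly b G -> hpoly (a + b) (fun v => F v * G v).
Proof.
elim: a F => [|a IH] F [T FT] hG.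
  by apply: hpoly_ext (hpolyZ T hG) => v; rewrite FT.
apply: (@hpoly_ext _ (fun v => \sum_(i < n) v ord0 i * (ev (T i) v * G v))).
  by move=> v; rewrite FT /= mulr_suml; apply: eq_bigr => i _; rewrite mulrA.
apply: hpoly_sum => i; apply: hpoly_coordM; apply: IH => //.
by exists (T i).
Qed.

Definition chpoly d (F : 'rV[R]_n -> R[i]) :=
  hpoly d (fun v => complex.Re (F v)) /\ hpoly d (fun v => complex.Im (F v)).

Lemma chpoly_ext d F G : F =1 G -> chpoly d F -> chpoly d G.
Proof.
by move=> FG [a b]; split; [apply: hpoly_ext a|apply: hpoly_ext b] => v; rewrite FG.
Qed.

Lemma ReM (x y : R[i]) : complex.Re (x * y) =
  complex.Re x * complex.Re y - complex.Im x * complex.Im y.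
Proof. by case: x y => [a b] [c d]. Qed.

Lemma ImM (x y : R[i]) : complex.Im (x * y) =
  complex.Re x * complex.Im y + complex.Im x * complex.Re y.
Proof. by case: x y => [a b] [c d]; rewrite /= addrC addrC. Qed.

Lemma chpolyC c : chpoly 0 (fun=> c).
Proof. by split; exact: hpolyC. Qed.

Lemma chpolyM a b F G : chpoly a F -> chpoly b G ->
  chpoly (a + b) (fun v => F v * G v).
Proof.
move=> [F1 F2] [G1 G2]; split.
  by apply: hpoly_ext (hpolyB (hpolyM F1 G1) (hpolyM F2 G2)) => v; rewrite ReM.
by apply: hpoly_ext (hpolyD (hpolyM F1 G2) (hpolyM F2 G1)) => v; rewrite ImM.
Qed.

Lemma chpolyX F k : chpoly 1 F -> chpoly k (fun v => F v ^+ k).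
Proof.
move=> hF; elim: k => [|k IH].
  by apply: chpoly_ext (chpolyC 1) => v; rewrite expr0.
by apply: chpoly_ext (chpolyM hF IH) => v; rewrite exprS.
Qed.

Lemma chpoly_conj d F : chpoly d F -> chpoly d (fun v => (F v)^*%C).
Proof.
move=> [F1 F2]; split; first by apply: hpoly_ext F1 => v; case: (F v).
by apply: hpoly_ext (hpolyZ (-1) F2) => v; rewrite mulN1r; case: (F v).
Qed.

Lemma chpoly_sum d m (F : 'I_m -> 'rV[R]_n -> R[i]) : (forall i, chpoly d (F i)) ->
  chpoly d (fun v => \sum_(i < m) F i v).
Proof.
move=> hF; split.
  by apply: hpoly_ext (hpoly_sum (fun i => (hF i).1)) => v; rewrite raddf_sum.
by apply: hpoly_ext (hpoly_sum (fun i => (hF i).2)) => v; rewrite raddf_sum.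
Qed.

Lemma chpoly0 d : chpoly d (fun=> 0).
Proof. by split; exact: hpoly0. Qed.

End HomogeneousPolynomials.

(** * Flow of a homogeneous cubic vector field *)

Section CubicFlow.
Context {R : realType} {n : nat}.
Implicit Types (P : 'I_n -> @tens R n 3) (v x y h : 'rV[R]_n).

Definition vfield P v : 'rV[R]_n := \row_j ev (P j) v.

(** Transposed with respect to the usual Jacobian: vectors are rows, so the differential is
    [h *m jac P v]. *)
Definition jac P v : 'M[R]_n := \matrix_(i, j) ev (pd i (P j)) v.

Lemma le_sum1 m (F : 'I_m -> R) j : (forall i, 0 <= F i) -> F j <= \sum_(i < m) F i.
Proof. by move=> F0; rewrite (bigD1 j)//= lerDl sumr_ge0. Qed.

Lemma cubic_bounds P : exists C : R, [/\ 0 <= C,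
  forall r x y, `|x| <= r -> `|y| <= r ->
    `|vfield P x - vfield P y| <= C * r ^+ 2 * `|x - y|,
  forall x, `|jac P x| <= C * `|x| ^+ 2,
  forall x y, `|x| <= 1 -> `|y| <= 1 -> `|jac P x - jac P y| <= C * `|x - y| &
  forall x h, `|x| <= 1 -> `|x + h| <= 1 ->
    `|vfield P (x + h) - vfield P x - h *m jac P x| <= C * `|h| ^+ 2].
Proof.
pose C1 := \sum_(j < n) tnorm (P j).
pose C2 := \sum_(j < n) \sum_(i < n) tnorm (pd i (P j)).
have C10 : 0 <= C1 by apply: sumr_ge0 => j _; exact: tnorm_ge0.
have C20 : 0 <= C2 by apply: sumr_ge0 => j _; apply: sumr_ge0 => i _; exact: tnorm_ge0.
have le1 j : tnorm (P j) <= C1 by apply: le_sum1 => i; exact: tnorm_ge0.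
have le2 i j : tnorm (pd i (P j)) <= C2.
  apply: le_trans (le_sum1 (F := fun i => tnorm (pd i (P j))) i _) _ => [k|].
    exact: tnorm_ge0.
  apply: (@le_sum1 _ (fun j => \sum_(i < n) tnorm (pd i (P j)))) => k.
  by apply: sumr_ge0 => l _; exact: tnorm_ge0.
(* 9 = 3^2 is the Taylor constant in degree 3 and exceeds the Lipschitz constant 3; 2 is the
   Lipschitz constant of the quadratic entries of the Jacobian. *)
have C0 : 0 <= 9 * C1 + 2 * C2 by lra.
exists (9 * C1 + 2 * C2); split=> //.
- move=> r x y xr yr; have r0 : 0 <= r by exact: le_trans xr.
  apply: mx_norm_le => [|i j]; first by rewrite !mulr_ge0// sqr_ge0.
  rewrite !mxE (le_trans (ev_lipschitz _ xr yr))// !ler_wpM2r ?sqr_ge0//.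
  by have := le1 j; lra.
- move=> x; apply: mx_norm_le => [|i j]; first by rewrite !mulr_ge0// sqr_ge0.
  rewrite !mxE (le_trans (ev_bound _ (lexx _)))// ler_wpM2r ?sqr_ge0//.
  by have := le2 i j; lra.
- move=> x y x1 y1; apply: mx_norm_le => [|i j]; first by rewrite mulr_ge0.
  rewrite !mxE (le_trans (ev_lipschitz _ x1 y1))// expr1n mulr1 ler_wpM2r//.
  by have := le2 i j; lra.
- move=> x h x1 h1; apply: mx_norm_le => [|i j].
    by rewrite !mulr_ge0// sqr_ge0.
  rewrite !mxE; have -> : \sum_k h i k * jac P x k j = dv (P j) x h.
    by rewrite dv_pd; apply: eq_bigr => k _; rewrite mxE (ord1 i).
  rewrite (le_trans (ev_taylor _ x1 h1))// ler_wpM2r ?sqr_ge0//.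
  by have := le1 j; rewrite (_ : (3 ^ 2)%N = 9%N)//; lra.
Qed.

Lemma vfield0 P : vfield P 0 = 0.
Proof.
apply/rowP => j; rewrite !mxE; apply/eqP; rewrite -normr_le0.
by rewrite (le_trans (ev_bound _ (lexx _)))// normr0 expr0n mulr0.
Qed.

Theorem cubic_flow P : exists (delta C : R) (gam : 'rV[R]_n -> R -> 'rV[R]_n)
    (J : 'rV[R]_n -> R -> 'M[R]_n), [/\ 0 < delta, 0 <= C,
  (forall v, `|v| <= delta -> exists K,
    [/\ 0 <= K, gam v 0 = v, J v 0 = 1%:M, qd (gam v) (fun t => vfield P (gam v t)) K &
        qd (J v) (fun t => J v t *m jac P (gam v t)) K]),
  (forall v (t : R), `|v| <= delta -> 0 <= t <= 1 ->
    `|gam v t| <= 2 * `|v| /\ `|gam v t - v| <= C * `|v| ^+ 3) &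
  (forall v w, `|v| <= delta -> `|w| <= delta -> gam v 1 = gam w 1 -> v = w) /\
  (forall v h, `|v| <= delta -> `|v + h| <= delta ->
    `|gam (v + h) 1 - gam v 1 - h *m J v 1| <= C * `|h| ^+ 2)].
Proof.
have [C [C0 Xlip Abnd Alip Xtay]] := cubic_bounds P.
(* Chosen so that rho <= 1, C rho^2 <= 1/2 and n C rho^2 <= 1/2. The last one is for matrix
   products, where the maximum norm is submultiplicative only up to the factor n. *)
pose rho : R := (2 * (n%:R + 1) * (C + 1))^-1.
have n0 : 0 <= n%:R :> R by [].
have D2 : 2 <= 2 * (n%:R + 1) * (C + 1).
  by rewrite -mulrA ler_peMr// -[1]mulr1 ler_pM//; lra.
have rho0 : 0 < rho by rewrite invr_gt0; lra.
have rhoD : rho * (2 * (n%:R + 1) * (C + 1)) = 1 by rewrite mulVf// gt_eqF//; lra.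
have rho1 : rho <= 1 by rewrite invf_le1; lra.
have rho2 : rho ^+ 2 <= rho by rewrite expr2 ler_piMl// ltW.
have rhoC : C * rho ^+ 2 <= 2^-1.
  have : C * rho ^+ 2 <= C * rho by rewrite ler_wpM2l.
  have : 0 <= rho * (n%:R * (C + 1)) by rewrite !mulr_ge0//; lra.
  by move: rhoD; nra.
have rhonC : n%:R * (C * rho ^+ 2) <= 2^-1.
  have : n%:R * (C * rho ^+ 2) <= n%:R * (C * rho) by rewrite !ler_wpM2l.
  have : 0 <= rho * (n%:R + 1) by rewrite !mulr_ge0//; lra.
  have : 0 <= rho * C by rewrite !mulr_ge0//; lra.
  have -> : n%:R * (C * rho) = rho * (n%:R + 1) * (C + 1) - rho * (n%:R + 1) - rho * C by ring.
  by move: rhoD; lra.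
have sml x : `|x| <= rho -> C * `|x| ^+ 2 <= 2^-1 /\ n%:R * (C * `|x| ^+ 2) <= 2^-1.
  move=> xr; have : `|x| ^+ 2 <= rho ^+ 2 by rewrite ler_sqr ?nnegrE// ltW.
  move=> le; split; first by apply: le_trans rhoC; rewrite ler_wpM2l.
  by apply: le_trans rhonC; rewrite !ler_wpM2l.
have /choice[gam gamP] : forall v, exists g : R -> 'rV[R]_n, 2 * `|v| <= rho ->
    [/\ g 0 = v, forall t : R, 0 <= t <= 1 -> `|g t - v| <= `|v| &
      qd g (fun t => vfield P (g t)) `|v|].
  move=> v; have [vr|_] := leP (2 * `|v|) rho; last by exists 0.
  have := @picard R 1 n (fun _ => vfield P) rho 0 v (lexx _).
  case=> //.
  - move=> t x y _ xr yr; apply: le_trans (Xlip _ _ _ xr yr) _.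
    by rewrite ler_wpM2r.
  - by move=> s t x _ _ _; rewrite subrr normr0 mul0r.
  - by move=> t _; exact: vfield0.
  - by move=> g [g0 gv gq]; exists g => _; rewrite add0r in gq.
have gam2 v (t : R) : 2 * `|v| <= rho -> 0 <= t <= 1 -> `|gam v t| <= 2 * `|v|.
  move=> vr t01; have [_ gv _] := gamP v vr.
  by have := ler_normD (gam v t - v) v; have := gv t t01; rewrite subrK; lra.
have gamr v (t : R) : 2 * `|v| <= rho -> 0 <= t <= 1 -> `|gam v t| <= rho.
  by move=> vr t01; apply: le_trans (gam2 _ _ vr t01) vr.
have Xsml x : `|x| <= rho -> `|vfield P x| <= 2^-1 * `|x|.
  move=> xr; have x0 : `|0 : 'rV[R]_n| <= `|x| by rewrite normr0.
  have := Xlip _ _ _ (lexx _) x0; rewrite vfield0 !subr0 => /le_trans; apply.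
  by rewrite ler_wpM2r//; exact: (sml _ xr).1.
pose I : 'M[R]_n := 1%:M.
have /choice[J JP] : forall v, exists J : R -> 'M[R]_n, 2 * `|v| <= rho ->
    exists K, [/\ 0 <= K, J 0 = I & qd J (fun t => J t *m jac P (gam v t)) K].
  move=> v; have [vr|_] := leP (2 * `|v|) rho; last by exists 0.
  have [g0 gv gq] := gamP v vr.
  have glip (s t : R) : 0 <= s <= 1 -> 0 <= t <= 1 ->
      `|gam v s - gam v t| <= (`|v| + 2^-1 * rho) * `|s - t|.
    apply: (qd_lipschitz _ gq) => // {}t t01.
    by apply: le_trans (Xsml _ (gamr _ _ vr t01)) _; rewrite ler_wpM2l// gamr.
  pose K := n%:R * (2 * `|I| * (C * (`|v| + 2^-1 * rho))).
  have K0 : 0 <= K by rewrite /K !mulr_ge0// addr_ge0// mulr_ge0// ltW.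
  (* The equation is linear in the matrix, so any radius is admissible; 2 |I| is the least one
     [picard] accepts for the initial value I. *)
  have := @picard R n n (fun t M => M *m jac P (gam v t)) (2 * `|I|) K I K0.
  case=> //.
  - move=> t M N t01 _ _; rewrite -mulmxBl (le_trans (mulmx_norm_le _ _))//.
    rewrite mulrCA mulrC ler_wpM2r//.
    apply: le_trans (sml _ (gamr _ _ vr t01)).2.
    by rewrite ler_wpM2l.
  - move=> s t M s01 t01 MI; rewrite -mulmxBr (le_trans (mulmx_norm_le _ _))//.
    have -> : K * `|s - t| =
      n%:R * (2 * `|I| * (C * ((`|v| + 2^-1 * rho) * `|s - t|))) by rewrite /K; ring.
    rewrite ler_wpM2l// ler_pM//.
    apply: le_trans (Alip _ _ _ _) _; rewrite ?(le_trans (gamr _ _ vr _) rho1)//.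
    by rewrite ler_wpM2l// glip.
  - by move=> t _; rewrite mul0mx.
  - move=> J [J0 _ Jq]; exists J => _; exists (K + `|I|); split => //.
    by rewrite addr_ge0.
(* Halving rho gives the condition 2 |v| <= rho. Both estimates below come out with 8 C: the
   displacement as C (2 |v|)^3, the differential as 2 * (4 C |h|^2); 32 leaves room. *)
exists (rho / 2), (32 * C), gam, J.
have dl v : `|v| <= rho / 2 -> 2 * `|v| <= rho by move=> ?; lra.
have Dq v w : 2 * `|v| <= rho -> 2 * `|w| <= rho ->
    qd (fun t => gam w t - gam v t) (fun t => vfield P (gam w t) - vfield P (gam v t))
      (`|w| + `|v|).
  by move=> vr wr; apply: qdB; [have [] := gamP w wr|have [] := gamP v vr].
have DX v w (t : R) : 2 * `|v| <= rho -> 2 * `|w| <= rho -> 0 <= t <= 1 ->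
    `|vfield P (gam w t) - vfield P (gam v t)| <= 2^-1 * `|gam w t - gam v t|.
  move=> vr wr t01.
  apply: le_trans (Xlip _ _ _ (gamr _ _ wr t01) (gamr _ _ vr t01)) _.
  by rewrite ler_wpM2r.
split.
- by rewrite divr_gt0.
- by rewrite mulr_ge0.
- move=> v /dl vr; have [g0 gv gq] := gamP v vr; have [K [K0 J0 Jq]] := JP v vr.
  exists (`|v| + K); split=> //; first by rewrite addr_ge0.
    move=> s t s01 t01; apply: le_trans (gq s t s01 t01) _.
    by rewrite ler_wpM2r ?sqr_ge0// lerDl.
  move=> s t s01 t01; apply: le_trans (Jq s t s01 t01) _.
  by rewrite ler_wpM2r ?sqr_ge0// lerDr.
- move=> v t /dl vr t01; split; first exact: gam2.
  have [g0 gv gq] := gamP v vr; rewrite -[X in _ - X]g0.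
  have B0 : 0 <= C * (2 * `|v|) ^+ 3 by rewrite mulr_ge0// exprn_ge0// mulr_ge0.
  have /andP[t0 t1] := t01.
  apply: le_trans (@qd_bound R _ _ _ _ `|v| (C * (2 * `|v|) ^+ 3) 0 t _ gq _ _ _ _ _) _ => //.
    move=> s st; have s01 : 0 <= s <= 1 by lra.
    have z0 : `|0 : 'rV[R]_n| <= 2 * `|v| by rewrite normr0 mulr_ge0.
    have := Xlip _ _ _ (gam2 _ _ vr s01) z0; rewrite vfield0 !subr0 => /le_trans; apply.
    have -> : C * (2 * `|v|) ^+ 3 = C * (2 * `|v|) ^+ 2 * (2 * `|v|) by ring.
    by rewrite ler_wpM2l ?gam2// mulr_ge0// sqr_ge0.
  rewrite subr0 (le_trans (ler_piMr _ _))// exprMn.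
  have : 0 <= C * `|v| ^+ 3 by rewrite mulr_ge0// exprn_ge0.
  by lra.
- split=> [v w /dl vr /dl wr vw|v h /dl vr /dl wr].
    (* Gronwall anchored at time 1 with B = 0: two trajectories that meet at time 1 agree at time
       0. *)
    have := @qd_gronwall R _ _ _ _ _ 0 1 _ (Dq w v wr vr) _ _ (lexx 0).
    rewrite vw subrr => /(_ _ _ erefl) H.
    have /H : 0 <= (0 : R) <= 1 by rewrite lexx ler01.
    have [-> _ _] := gamP v vr; have [-> _ _] := gamP w wr.
    rewrite mulr0 normr_le0 subr_eq0 => H'; apply/eqP/H' => //.
    + by rewrite lexx ler01.
    + by move=> t t01; rewrite addr0; exact: DX.
  have : v + h - v - h = 0 by rewrite [v + h]addrC addrK subrr.
  move: (v + h) wr => w wr wvh.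
  have [K [K0 J0 Jq]] := JP v vr.
  have [gv0 _ _] := gamP v vr; have [gw0 _ _] := gamP w wr.
  have D2h (t : R) : 0 <= t <= 1 -> `|gam w t - gam v t| <= 2 * `|h|.
    (* Subtracting the constant curve h makes the difference vanish at time 0, as Gronwall requires;
       B = |h| / 2 then bounds the deviation from h by |h|. *)
    move=> t01; have ch : qd (fun _ : R => h) (fun _ => 0) 0.
      by move=> s s' _ _; rewrite subrr scaler0 subr0 normr0 mul0r.
    have z01 : 0 <= (0 : R) <= 1 by rewrite lexx ler01.
    have := @qd_gronwall R _ _ _ _ _ (2^-1 * `|h|) 0 _ (qdB (Dq v w vr wr) ch) z01.
    have wv0 : 0 <= `|w| + `|v| + 0 by rewrite !addr_ge0.
    have h0 : 0 <= 2^-1 * `|h| by rewrite mulr_ge0.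
    rewrite gv0 gw0 => /(_ wv0 wvh h0) H.
    have : `|gam w t - gam v t - h| <= 2 * (2^-1 * `|h|).
      apply: (H _ t t01) => s s01; rewrite subr0; apply: le_trans (DX _ _ _ vr wr s01) _.
      by have := ler_normD (gam w s - gam v s - h) h; rewrite subrK; lra.
    by have := ler_normD (gam w t - gam v t - h) h; rewrite subrK; lra.
  have z01 : 0 <= (0 : R) <= 1 by rewrite lexx ler01.
  have B0 : 0 <= 4 * C * `|h| ^+ 2 by rewrite !mulr_ge0// sqr_ge0.
  have KK : 0 <= `|w| + `|v| + n%:R * (`|h| * K) by rewrite !addr_ge0// !mulr_ge0.
  have := @qd_gronwall R _ _ _ _ _ (4 * C * `|h| ^+ 2) 0 KK
    (qdB (Dq v w vr wr) (qd_mulmx h Jq)) z01.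
  rewrite gv0 gw0 J0 /I mulmx1 => /(_ wvh B0) H.
  have o01 : 0 <= (1 : R) <= 1 by rewrite lexx ler01.
  apply: le_trans (H _ _ o01) _; last first.
    by have : 0 <= C * `|h| ^+ 2 by [rewrite mulr_ge0// sqr_ge0]; lra.
  move=> t t01; rewrite [leRHS]addrC.
  set d := gam w t - gam v t.
  have e : gam v t + d = gam w t by rewrite /d addrC subrK.
  (* The Taylor remainder, at most C (2 |h|)^2, plays the role of B; the second term is linear in
     the unknown d - h J, with factor n |jac| <= 1/2. *)
  have -> : vfield P (gam w t) - vfield P (gam v t) - h *m (J v t *m jac P (gam v t)) =
    (vfield P (gam v t + d) - vfield P (gam v t) - d *m jac P (gam v t))
    + (d - h *m J v t) *m jac P (gam v t).
    by rewrite e (mulmxBl d) mulmxA [RHS]addrA subrK.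
  apply: le_trans (ler_normD _ _) _; apply: lerD.
    apply: le_trans (Xtay _ _ _ _) _.
    + exact: le_trans (gamr _ _ vr t01) rho1.
    + by rewrite e; exact: le_trans (gamr _ _ wr t01) rho1.
    + rewrite (_ : 4 * C * `|h| ^+ 2 = C * (2 * `|h|) ^+ 2); last by ring.
      by rewrite ler_wpM2l// ler_sqr ?nnegrE ?mulr_ge0// D2h.
  apply: le_trans (mulmx_norm_le _ _) _; rewrite mulrCA mulrC ler_wpM2r//.
  apply: le_trans (sml _ (gamr _ _ vr t01)).2.
  by rewrite ler_wpM2l.
Qed.

End CubicFlow.

(** * Real coordinates and Hamilton's equations *)

Section ComplexCoordinates.
Context {R : realType}.
Implicit Types (v u w : 'rV[R]_4) (j : 'I_2).

Lemma cxE j : cx j = (2 * j)%N :> nat.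
Proof. by rewrite inordK//; case: j => -[|[]]. Qed.

Lemma cyE j : cy j = (2 * j).+1 :> nat.
Proof. by rewrite inordK ?addn1//; case: j => -[|[]]. Qed.

Lemma sum4 (V : nmodType) (F : 'I_4 -> V) :
  \sum_(k < 4) F k = \sum_(j < 2) (F (cx j) + F (cy j)).
Proof.
rewrite !big_ord_recl !big_ord0 !addr0 !addrA.
by congr (F _ + F _ + F _ + F _); apply: val_inj; rewrite [RHS](cxE, cyE).
Qed.

Lemma coordP (k : 'I_4) : exists j, k = cx j \/ k = cy j.
Proof.
have j2 : (k./2 < 2)%N by case: k => -[|[|[|[]]]].
exists (Ordinal j2); have := odd_double_half k; rewrite -mul2n.
by case: (odd k) => e; [right|left]; apply: val_inj; rewrite /= ?cxE ?cyE /=; exact: esym.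
Qed.

Lemma cmod_re (x : R) : cmod (x%:C)%C = `|x|.
Proof. by rewrite /cmod/= expr0n addr0 sqrtr_sqr. Qed.

Lemma cmod_ge (z : R[i]) : `|complex.Re z| <= cmod z /\ `|complex.Im z| <= cmod z.
Proof.
by rewrite -!sqrtr_sqr; split; apply: ler_wsqrtr; rewrite ?lerDl ?lerDr sqr_ge0.
Qed.

Lemma cmod_le (z : R[i]) : cmod z <= `|complex.Re z| + `|complex.Im z|.
Proof.
rewrite /cmod -[leRHS]ger0_norm ?addr_ge0// -sqrtr_sqr; apply: ler_wsqrtr.
rewrite sqrrD !real_normK ?num_real//.
have : 0 <= `|complex.Re z| * `|complex.Im z| by rewrite mulr_ge0.
by lra.
Qed.

Lemma norm_le_nrm v : `|v| <= nrm v.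
Proof.
have cv j : cmod (zc v j) <= nrm v.
  rewrite /nrm le_max; case: j => -[|[|//]] jlt; apply/orP; [left|right];
  by rewrite le_eqVlt; apply/orP; left; apply/eqP; congr (cmod (zc v _)); apply: val_inj.
apply: mx_norm_le => [|i k].
  by apply: le_trans (cv 0); rewrite sqrtr_ge0.
rewrite (ord1 i); have [j [->|->]] := coordP k; apply: le_trans (cv j).
  exact: (cmod_ge (zc v j)).1.
exact: (cmod_ge (zc v j)).2.
Qed.

Lemma nrm_le_norm v : nrm v <= 2 * `|v|.
Proof.
have cv j : cmod (zc v j) <= 2 * `|v|.
  apply: le_trans (cmod_le _) _; rewrite /=.
  have := mx_coord_le v ord0 (cx j); have := mx_coord_le v ord0 (cy j); lra.
by rewrite /nrm ge_max !cv.
Qed.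

Lemma is_derive_coord v u i : is_derive v u (fun x : 'rV[R]_4 => x ord0 i) (u ord0 i).
Proof.
have did : derivable (@id 'rV[R]_4) v u by exact: derivable_id.
split; first by move/derivable_mxP : did; exact.
by have /matrixP/(_ ord0 i) := derive_mx did; rewrite derive_id mxE.
Qed.

(** * Wirtinger derivatives and brackets of real polynomials *)

Lemma dre_real d (T : @tens R 4 d) u v :
  dre (fun w => (ev T w)%:C)%C u v = (dv T v u)%:C%C.
Proof.
have dT : is_derive v u (fun w : 'rV[R]_4 => ev T w) (dv T v u).
  by apply: (@is_derive_ev _ _ _ id) => i; exact: is_derive_coord.
by rewrite /dre/= derive_val derive_cst.
Qed.

Lemma dv_ex d (T : @tens R 4 d.+1) j v : dv T v (ex R j) = ev (pd (cx j) T) v.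
Proof.
rewrite dv_pd (bigD1 (cx j))//= big1 => [|k kj]; rewrite mxE ?eqxx ?mul1r ?addr0//.
by rewrite (negbTE kj) andbF mul0r.
Qed.

Lemma dv_ey d (T : @tens R 4 d.+1) j v : dv T v (ey R j) = ev (pd (cy j) T) v.
Proof.
rewrite dv_pd (bigD1 (cy j))//= big1 => [|k kj]; rewrite mxE ?eqxx ?mul1r ?addr0//.
by rewrite (negbTE kj) andbF mul0r.
Qed.

Lemma dz_real d (T : @tens R 4 d.+1) j v :
  dz (fun w => (ev T w)%:C)%C j v =
  ((2^-1 * ev (pd (cx j) T) v) +i* (- (2^-1 * ev (pd (cy j) T) v)))%C.
Proof.
rewrite /dz !dre_real dv_ex dv_ey; apply/eqP; rewrite eq_complex /=.
by apply/andP; split; apply/eqP; ring.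
Qed.

Lemma dzb_real d (T : @tens R 4 d.+1) j v :
  dzb (fun w => (ev T w)%:C)%C j v =
  ((2^-1 * ev (pd (cx j) T) v) +i* (2^-1 * ev (pd (cy j) T) v))%C.
Proof.
rewrite /dzb !dre_real dv_ex dv_ey; apply/eqP; rewrite eq_complex /=.
by apply/andP; split; apply/eqP; ring.
Qed.

(* In real coordinates Hamilton's equations of a real K read
   x_j' = (1/2) dK/dy_j and y_j' = -(1/2) dK/dx_j. *)
Definition hfield d (T : @tens R 4 d.+1) (k : 'I_4) : @tens R 4 d :=
  if odd k then tscale (- 2^-1) (pd (inord k.-1) T)
  else tscale 2^-1 (pd (inord k.+1) T).

Lemma hfieldE_cx d (T : @tens R 4 d.+1) j :
  hfield T (cx j) = tscale 2^-1 (pd (cy j) T).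
Proof. by rewrite /hfield cxE mul2n odd_double /cy mul2n addn1. Qed.

Lemma hfieldE_cy d (T : @tens R 4 d.+1) j :
  hfield T (cy j) = tscale (- 2^-1) (pd (cx j) T).
Proof. by rewrite /hfield cyE mul2n /= odd_double /cx mul2n. Qed.

Lemma hfield_cx d (T : @tens R 4 d.+1) j v :
  ev (hfield T (cx j)) v = 2^-1 * ev (pd (cy j) T) v.
Proof. by rewrite hfieldE_cx ev_tscale. Qed.

Lemma hfield_cy d (T : @tens R 4 d.+1) j v :
  ev (hfield T (cy j)) v = - (2^-1 * ev (pd (cx j) T) v).
Proof. by rewrite hfieldE_cy ev_tscale mulNr. Qed.

Lemma zc_hfield (T : @tens R 4 4) j v :
  zc (vfield (hfield T) v) j = - 'i * dzb (fun w => (ev T w)%:C)%C j v /\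
  (zc (vfield (hfield T) v) j)^*%C = 'i * dz (fun w => (ev T w)%:C)%C j v.
Proof.
rewrite dzb_real dz_real /zc !mxE hfield_cx hfield_cy.
by split; apply/eqP; rewrite eq_complex /=; apply/andP; split; apply/eqP; ring.
Qed.

(** With this sign convention the bracket with S on the left is the derivative along the flow of S.
    The factors 1/2 of two Wirtinger derivatives, times twice an imaginary part, leave the 1/2 of
    [hfield]. *)
Lemma pb_real a (S : @tens R 4 4) (N : @tens R 4 a.+1) v :
  pb (fun w => (ev S w)%:C)%C (fun w => (ev N w)%:C)%C v =
  (dv N v (vfield (hfield S) v))%:C%C.
Proof.
rewrite dv_pd sum4 /pb mulr_sumr raddf_sum; apply: eq_bigr => j _.
rewrite !dz_real !dzb_real !mxE hfield_cx hfield_cy; apply/eqP.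
rewrite eq_complex /=; apply/andP; split; apply/eqP; by field.
Qed.

Lemma time_one_qd (T : @tens R 4 4) (gam : R -> 'rV[R]_4) (Phi1 : 'rV[R]_4 -> 'rV[R]_4)
    (K : R) v : 0 <= K -> gam 0 = v -> gam 1 = Phi1 v ->
  qd gam (fun t => vfield (hfield T) (gam t)) K ->
  time_one (fun w => (ev T w)%:C)%C Phi1 v.
Proof.
move=> K0 g0 g1 gq; exists gam; split=> //; split; first exact: qd_continuous gq.
move=> t t01; have dg := qd_is_derive gq t01; split; first by [].
by move=> j; rewrite derive_val; exact: zc_hfield.
Qed.

Lemma ev_pd_tscale n d c i (T : @tens R n d.+1) (x : 'rV[R]_n) :
  ev (pd i (tscale c T)) x = c * ev (pd i T) x.
Proof.
elim: d T => [//|d IH] T.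
rewrite (pdS i (tscale c T)) (pdS i T) !ev_tadd mulrDr.
congr (_ + _); first by rewrite -ev_tscale.
rewrite /= mulr_sumr; apply: eq_bigr => l _.
by rewrite mulrCA; congr (_ * _); exact: IH.
Qed.

(** Contracting with [omega2] turns the Jacobian of [hfield T] into half the Hessian of T; the two
    terms carry opposite signs and cancel by the symmetry [pdC]. *)
Lemma omega2_jac (T : @tens R 4 4) v u w :
  omega2 (u *m jac (hfield T) v) w + omega2 u (w *m jac (hfield T) v) = 0.
Proof.
pose H i k := ev (pd i (pd k T)) v.
have HC i k : H i k = H k i by exact: pdC.
have jx (a : 'rV[R]_4) j : (a *m jac (hfield T) v) ord0 (cx j) =
    2^-1 * \sum_(i < 4) a ord0 i * H i (cy j).
  rewrite mxE mulr_sumr; apply: eq_bigr => i _; rewrite mxE mulrCA; congr (_ * _).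
  by rewrite hfieldE_cx ev_pd_tscale.
have jy (a : 'rV[R]_4) j : (a *m jac (hfield T) v) ord0 (cy j) =
    - (2^-1 * \sum_(i < 4) a ord0 i * H i (cx j)).
  rewrite mxE mulr_sumr -sumrN; apply: eq_bigr => i _; rewrite mxE.
  rewrite mulrCA -mulrN; congr (_ * _).
  by rewrite hfieldE_cy ev_pd_tscale mulNr.
have -> : omega2 (u *m jac (hfield T) v) w =
    2^-1 * \sum_(k < 4) \sum_(i < 4) u ord0 i * H i k * w ord0 k.
  rewrite sum4 mulr_sumr; apply: eq_bigr => j _; rewrite jx jy -!mulr_suml.
  by ring.
have -> : omega2 u (w *m jac (hfield T) v) =
    - (2^-1 * \sum_(k < 4) \sum_(i < 4) w ord0 i * H i k * u ord0 k).
  rewrite sum4 mulr_sumr -sumrN; apply: eq_bigr => j _; rewrite jx jy -!mulr_suml.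
  by ring.
rewrite [in X in _ - X]exchange_big/=; apply/eqP; rewrite subr_eq0; apply/eqP.
congr (_ * _); apply: eq_bigr => k _; apply: eq_bigr => i _.
by rewrite HC; ring.
Qed.

(** By [omega2_jac] the pairing of u J(s) and w J(s) has zero derivative, so the mean value bound
    with constant 0 makes it equal at both ends. *)
Lemma symplectic_qd (T : @tens R 4 4) (gam : R -> 'rV[R]_4) (J : R -> 'M[R]_4) (K : R) u w :
  0 <= K -> J 0 = 1%:M ->
  qd J (fun t => J t *m jac (hfield T) (gam t)) K ->
  omega2 (u *m J 1) (w *m J 1) = omega2 u w.
Proof.
move=> K0 J0 Jq.
have qmul (a : 'rV[R]_4) := qd_mulmx a Jq.
have Ka (a : 'rV[R]_4) : 0 <= 4%:R * (`|a| * K) by rewrite !mulr_ge0.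
have da (a : 'rV[R]_4) k (t : R) : 0 < t < 1 ->
    is_derive t 1 (fun s => (a *m J s) ord0 k) ((a *m (J t *m jac (hfield T) (gam t))) ord0 k).
  exact: qd_is_derive (qd_coord ord0 k (qmul a)).
have ca (a : 'rV[R]_4) k : {within `[0, 1], continuous (fun s : R => (a *m J s) ord0 k)}%classic.
  exact: qd_continuous (qd_coord ord0 k (qmul a)).
pose f := fun s : R => omega2 (u *m J s) (w *m J s).
have fE : f = \sum_(j < 2)
   ((fun s => (u *m J s) ord0 (cx j)) * (fun s => (w *m J s) ord0 (cy j))
   - (fun s => (u *m J s) ord0 (cy j)) * (fun s => (w *m J s) ord0 (cx j))).
  by apply/funext => s; rewrite fct_sumE.
have f1 : `|f 1 - f 0| <= 0 * (1 - 0).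
  apply: (@mean_value_bound _ f (fun=> 0)) => //.
  - move=> t t01; rewrite fE.
    have := da; move=> /(_ _ _ t t01) {}da.
    apply: is_derive_eq; rewrite -[RHS](omega2_jac T (gam t) (u *m J t) (w *m J t)).
    rewrite /omega2 -big_split; apply: eq_bigr => j _.
    by rewrite /GRing.scale/= !mulmxA; ring.
  - rewrite fE; move=> s.
    rewrite !big_ord_recl big_ord0 addr0.
    by apply: cvgD; apply: cvgB; apply: cvgM; exact: ca.
  - by move=> x _; rewrite normr0.
move: f1; rewrite mul0r normr_le0 subr_eq0 => /eqP; rewrite /f J0 !mulmx1.
by [].
Qed.

Lemma lipschitz_continuous (V W : normedModType R) (f : V -> W) (K : R) :
  (forall x y, `|f x - f y| <= K * `|x - y|) -> continuous f.
Proof.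
move=> fK x; apply/cvgrPdist_le => e e0; near=> y.
have K0 : 0 < `|K| + 1 by rewrite ltr_wpDl.
rewrite (le_trans (fK _ _))//.
apply: (@le_trans _ _ ((`|K| + 1) * `|x - y|)).
  by rewrite ler_wpM2r// (le_trans (ler_norm _))// lerDl.
rewrite -ler_pdivlMl// mulrC; near: y.
by apply: cvgr_dist_le => //; rewrite divr_gt0.
Unshelve. all: by end_near. Qed.

Lemma quadratic_remainder_diff (V W : normedModType R) (f : V -> W)
    (L : {linear V -> W}) (C delta : R) (a : V) :
  0 < delta -> continuous L ->
  (forall h, `|h| <= delta -> `|f (a + h) - f a - L h| <= C * `|h| ^+ 2) ->
  differentiable f a /\ forall h, 'd f a h = L h.
Proof.
move=> d0 cL fL.
have H : f \o shift a = cst (f a) + L +o_ 0 id.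
  apply/eqaddoP => _/posnumP[e].
  have C1 : 0 < `|C| + 1 by rewrite ltr_wpDl.
  near=> h.
  have hd : `|h| <= delta by near: h; exact: nbhs0_le.
  have he : `|h| <= e%:num / (`|C| + 1).
    by near: h; apply: nbhs0_le; rewrite divr_gt0.
  rewrite [X in `|X|](_ : _ = f (a + h) - f a - L h); last first.
    by rewrite -addrA -opprD (addrC a).
  apply: le_trans (fL _ hd) _; rewrite /= expr2 mulrA ler_wpM2r//.
  apply: (@le_trans _ _ ((`|C| + 1) * `|h|)).
    by rewrite ler_wpM2r// (le_trans (ler_norm _))// lerDl.
  by rewrite -ler_pdivlMl// mulrC.
have dE := diff_unique cL H.
split; last by move=> h; rewrite dE.
by apply/diff_locallyP; rewrite dE.
Unshelve. all: by end_near. Qed.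

Lemma within_continuous_ev n d (T : @tens R n d) (g : R -> 'rV[R]_n) (A : set R) :
  (forall i, {within A, continuous (fun t => g t ord0 i)})%classic ->
  {within A, continuous (fun t => ev T (g t))}%classic.
Proof.
move=> cg; elim: d T => [|d IH] T; first by move=> x; exact: cvg_cst.
have -> : (fun t => ev T (g t)) =
    \sum_(i < n) ((fun t => g t ord0 i) * (fun t => ev (slice T i) (g t))).
  by apply/funext => v; rewrite fct_sumE.
apply: (big_ind (fun F : R -> R => {within A, continuous F}%classic)).
- by move=> x; exact: cvg_cst.
- by move=> F G cF cG x; apply: cvgD; [exact: cF|exact: cG].
- by move=> i _ x; apply: cvgM; [exact: cg|exact: IH].
Qed.

End ComplexCoordinates.

(** * Normal form from a homological equation *)

Section NormalForm.
Context {R : realType}.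
Variables (Phi : 'M[R]_2) (M3 N3 wm wp : R).

Lemma hpolyX n F k : @hpoly R n 1 F -> @hpoly R n k (fun v => F v ^+ k).
Proof.
move=> hF; elim: k => [|k IH].
  by apply: hpoly_ext (hpolyC 1) => v; rewrite expr0.
by apply: hpoly_ext (hpolyM hF IH) => v; rewrite exprS.
Qed.

Lemma Gham_real : exists T : @tens R 4 4,
  forall v, Gham Phi M3 N3 wm wp v = (ev T v)%:C%C.
Proof.
suff [T TE] : @hpoly R 4 4 (fun v => ff Phi M3 N3
      (complex.Re (zc v 0 + (zc v 0)^*%C) / Num.sqrt (2 * wm))
      (complex.Re (zc v 1 + (zc v 1)^*%C) / Num.sqrt (2 * wp))).
  by exists T => v; rewrite -TE.
have hq (a b : R) (i j : 'I_2) : @hpoly R 4 1 (fun v =>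
    a * (complex.Re (zc v i + (zc v i)^*%C) / Num.sqrt (2 * wm)) +
    b * (complex.Re (zc v j + (zc v j)^*%C) / Num.sqrt (2 * wp))).
  apply: hpoly_ext (hpolyD
    (hpolyZ (a * 2 / Num.sqrt (2 * wm)) (hpoly_coord (cx i)))
    (hpolyZ (b * 2 / Num.sqrt (2 * wp)) (hpoly_coord (cx j)))) => v /=.
  by ring.
apply: hpolyD; apply: hpolyZ; apply: hpolyX; exact: hq.
Qed.

Definition Ntens : @tens R 4 2 :=
  fun k l => if k == l then (if (k < 2)%N then wm else wp) else 0.

Lemma ev_pd_Ntens (k : 'I_4) v :
  ev (pd k Ntens) v = 2 * (if (k < 2)%N then wm else wp) * v ord0 k.
Proof.
rewrite /= (bigD1 k)//= big1 => [|l lk].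
  by rewrite /slice /Ntens eqxx addr0; ring.
by rewrite /slice /Ntens /= [k == l]eq_sym (negbTE lk) addr0 mulr0.
Qed.

Lemma ev_Ntens v :
  ev Ntens v = \sum_(k < 4) (if (k < 2)%N then wm else wp) * v ord0 k ^+ 2.
Proof.
rewrite /=; apply: eq_bigr => k _; rewrite (bigD1 k)//= big1 => [|l lk].
  by rewrite /slice /Ntens eqxx addr0; ring.
by rewrite /slice /Ntens eq_sym (negbTE lk) mulr0.
Qed.

Lemma Nham_real : Nham wm wp = fun v => (ev Ntens v)%:C%C.
Proof.
apply/funext => v; rewrite ev_Ntens sum4 !big_ord_recl big_ord0 addr0 /Nham.
rewrite !cxE !cyE; apply/eqP; rewrite eq_complex /=.
by apply/andP; split; apply/eqP; ring.
Qed.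

Lemma normal_form_real (S Hb : 'rV[R]_4 -> R[i]) (T : @tens R 4 4) :
  S = (fun v => (ev T v)%:C%C) ->
  (forall v, Gham Phi M3 N3 wm wp v + pb S (Nham wm wp) v = Hb v) ->
  normal_form Phi M3 N3 wm wp S Hb.
Proof.
move=> SE hom; split=> //.
have [TG GE] := Gham_real.
have [delta [C [gam [J [d0 C0 flow bnd [inj dif]]]]]] := cubic_flow (hfield T).
(* The bracket {S, N} as a polynomial: a cubic field times the linear gradient of N. *)
have [TP TPE] : @hpoly R 4 4 (fun v => dv Ntens v (vfield (hfield T) v)).
  have hk (k : 'I_4) : @hpoly R 4 4 (fun v => ev (hfield T k) v * ev (pd k Ntens) v).
    apply: (@hpolyM _ _ 3 1); [by exists (hfield T k)|by exists (pd k Ntens)].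
  apply: hpoly_ext (hpoly_sum hk) => v; rewrite dv_pd.
  by apply: eq_bigr => k _; rewrite mxE.
exists delta; split => //.
(* 2 C pays for passing from the maximum norm on R^4 to [nrm]. 32 = 4 * 2^3 is the Lipschitz factor
   of a quartic on the ball of radius 2 |v|, multiplied by the displacement C |v|^3. *)
exists (2 * C + 32 * (tnorm TP + tnorm TG) * C), (fun v => gam v 1).
have le_d v : nrm v < delta -> `|v| < delta by exact: le_lt_trans (norm_le_nrm v).
have tP := tnorm_ge0 TP; have tG := tnorm_ge0 TG.
have tC : 0 <= 32 * (tnorm TP + tnorm TG) * C by rewrite !mulr_ge0// addr_ge0.
split=> [v w /le_d/ltW vd /le_d/ltW wd|v /le_d vd]; first exact: inj.
have vd' := ltW vd; have [K [K0 g0 J0 gq Jq]] := flow v vd'.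
have b1 : 0 <= (1 : R) <= 1 by rewrite ler01 lexx.
have poly4 (U : @tens R 4 4) (t : R) : 0 <= t <= 1 ->
    `|ev U (gam v t) - ev U v| <= 32 * tnorm U * C * `|v| ^+ 6.
  move=> t01; have [g2 g3] := bnd v t vd' t01.
  have v2 : `|v| <= 2 * `|v| by rewrite ler_peMl//; lra.
  apply: le_trans (ev_lipschitz U g2 v2) _.
  have U0 : 0 <= 32 * tnorm U * `|v| ^+ 3.
    by rewrite !mulr_ge0// ?tnorm_ge0// exprn_ge0.
  rewrite (_ : 4%:R * tnorm U * (2 * `|v|) ^+ 4.-1 = 32 * tnorm U * `|v| ^+ 3); last first.
    by rewrite /=; ring.
  apply: le_trans (ler_wpM2l U0 g3) _.
  by rewrite le_eqVlt; apply/orP; left; apply/eqP; ring.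
split.
- by rewrite SE; exact: (time_one_qd (Phi1 := fun v => gam v 1) K0 g0 erefl gq).
(* The radius [delta - |v|] keeps v + h in the ball where the flow is controlled; it is positive
   because |v| < delta strictly. *)
- have [||h hd|df dE] := @quadratic_remainder_diff R _ _ (fun v => gam v 1)
      (mulmxr (J v 1)) C (delta - `|v|) v.
  + by rewrite subr_gt0.
  + apply: (@lipschitz_continuous _ _ _ _ (4%:R * `|J v 1|)) => x y.
    rewrite /= -mulmxBl (le_trans (mulmx_norm_le _ _))//.
    by rewrite -mulrA (mulrC `|J v 1|).
  + apply: dif => //; rewrite (le_trans (ler_normD _ _))//.
    by rewrite -lerBrDl.
  split=> // u w; rewrite !dE; exact: symplectic_qd K0 J0 Jq.
- have [_ g3] := bnd v 1 vd' b1.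
  apply: le_trans (nrm_le_norm _) _; apply: le_trans (ler_wpM2l _ g3) _ => //.
  rewrite mulrA ler_pM ?mulr_ge0 ?exprn_ge0//; first by rewrite lerDl.
  by rewrite lerXn2r ?nnegrE ?norm_le_nrm// (le_trans _ (norm_le_nrm v)).
- rewrite -hom /Hham SE Nham_real pb_real !GE.
  have -> : (ev Ntens (gam v 1))%:C%C + (ev TG (gam v 1))%:C%C - (ev Ntens v)%:C%C
      - ((ev TG v)%:C%C + (dv Ntens v (vfield (hfield T) v))%:C%C) =
    ((ev Ntens (gam v 1) - ev Ntens v - ev TP v)
      + (ev TG (gam v 1) - ev TG v))%:C%C.
    by rewrite TPE !rmorphD !rmorphN /=; ring.
  rewrite cmod_re; apply: le_trans (ler_normD _ _) _.
  have hN : `|ev Ntens (gam v 1) - ev Ntens v - ev TP v| <= 32 * tnorm TP * C * `|v| ^+ 6.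
    (* Subtracting t P(v) leaves the derivative P(gam t) - P(v), already of order six by [poly4]. *)
    have := @mean_value_bound R (fun t => ev Ntens (gam v t) - t * ev TP v)
      (fun t => ev TP (gam v t) - ev TP v) 0 1 (32 * tnorm TP * C * `|v| ^+ 6) ler01.
    rewrite mul1r mul0r g0 !subr0 mulr1 addrAC; apply.
    + move=> t t01.
      have d1 : is_derive t 1 (fun s => ev Ntens (gam v s)) (ev TP (gam v t)).
        rewrite -TPE; apply: is_derive_ev => i.
        exact: qd_is_derive (qd_coord ord0 i gq) t01.
      have d2 : is_derive t 1 (fun y : R => y * ev TP v) (ev TP v).
        by apply: is_derive_eq; rewrite scaler0 add0r /GRing.scale/= mulr1.
      exact: is_deriveB d1 d2.
    + have c1 : {within `[0, 1], continuous (fun s : R => ev Ntens (gam v s))}%classic.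
        apply: within_continuous_ev => i.
        exact: qd_continuous K0 (qd_coord ord0 i gq).
      have c2 : {within `[0, 1], continuous (fun y : R => y * ev TP v)}%classic.
        apply: (@lipschitz_within _ _ _ _ `|ev TP v|) => y z _ _.
        by rewrite -mulrBl normrM mulrC.
      by move=> x; apply: cvgB; [exact: c1|exact: c2].
    + by move=> t t01; exact: poly4.
  apply: le_trans (lerD hN (poly4 TG 1 b1)) _.
  rewrite -mulrDl; apply: (@ler_pM).
  + by rewrite addr_ge0// !mulr_ge0.
  + by rewrite exprn_ge0.
  + by rewrite -mulrDl -mulrDr lerDr mulr_ge0.
  + by rewrite lerXn2r ?nnegrE ?norm_le_nrm// (le_trans _ (norm_le_nrm v)).
Qed.

End NormalForm.

(** * Monomials under the flow of the quadratic part *)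

Section Homological.
Context {R : realType}.
Local Open Scope complex_scope.
Implicit Types (v : 'rV[R]_4) (c : nat -> nat -> nat -> nat -> R[i]).

Lemma conj_mono a1 a2 b1 b2 v : Num.conj (mono a1 a2 b1 b2 v) = mono b1 b2 a1 a2 v.
Proof. by rewrite /mono !rmorphM !rmorphXn /= !conjCK; ring. Qed.

Lemma exchange_quadruple_sum (F : 'I_5 -> 'I_5 -> 'I_5 -> 'I_5 -> R[i]) :
  \sum_a \sum_b \sum_c \sum_d F c d a b = \sum_a \sum_b \sum_c \sum_d F a b c d.
Proof.
transitivity (\sum_(p : 'I_5 * 'I_5) \sum_(q : 'I_5 * 'I_5) F q.1 q.2 p.1 p.2).
  by rewrite pair_bigA; apply: eq_bigr => p _; rewrite pair_bigA.
rewrite exchange_big [RHS]pair_bigA; apply: eq_bigr => p _.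
by rewrite pair_bigA.
Qed.

(** Conjugation swaps the two exponent pairs of a monomial, so it only permutes the terms of the
    sum. *)
Lemma conj_quartic c v : (forall a1 a2 b1 b2, Num.conj (c a1 a2 b1 b2) = c b1 b2 a1 a2) ->
  Num.conj (quartic c v) = quartic c v.
Proof.
move=> cc; rewrite /quartic -[RHS]exchange_quadruple_sum.
rewrite rmorph_sum; apply: eq_bigr => a1 _.
rewrite rmorph_sum; apply: eq_bigr => a2 _.
rewrite rmorph_sum; apply: eq_bigr => b1 _.
rewrite rmorph_sum; apply: eq_bigr => b2 _.
rewrite (_ : (b1 + b2 + a1 + a2)%N = (a1 + a2 + b1 + b2)%N); last by lia.
by case: ifP => _; rewrite ?rmorph0// rmorphM /= cc conj_mono.
Qed.

Lemma chpoly_quartic c : @chpoly R 4 4 (quartic c).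
Proof.
rewrite /quartic.
apply: chpoly_sum => a1; apply: chpoly_sum => a2.
apply: chpoly_sum => b1; apply: chpoly_sum => b2.
case: (boolP (a1 + a2 + b1 + b2 == 4)%N) => [/eqP e|_]; last exact: chpoly0.
have hz j : @chpoly R 4 1 (fun v => zc v j).
  by split; [exact: (hpoly_coord (cx j))|exact: (hpoly_coord (cy j))].
have := chpolyM (chpolyC (c a1 a2 b1 b2)) (chpolyM (chpolyM (chpolyM
  (chpolyX a1 (hz 0)) (chpolyX a2 (hz 1)))
  (chpolyX b1 (chpoly_conj (hz 0)))) (chpolyX b2 (chpoly_conj (hz 1)))).
by rewrite add0n e.
Qed.

Lemma quartic_real c : (forall a1 a2 b1 b2, Num.conj (c a1 a2 b1 b2) = c b1 b2 a1 a2) ->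
  exists T : @tens R 4 4, quartic c = fun v => (ev T v)%:C.
Proof.
move=> cc; have [[T TE] _] := chpoly_quartic c; exists T; apply/funext => v.
have := conj_quartic v cc; rewrite -TE -[Num.conj _]/(conjc _); case: (quartic c v) => x y /= [] yy.
by apply/eqP; rewrite eq_complex /= eqxx /=; apply/eqP; lra.
Qed.

(** * Derivatives of complex-valued functions, by real and imaginary parts *)

Lemma ReD (x y : R[i]) : complex.Re (x + y) = complex.Re x + complex.Re y.
Proof. by case: x y => [a b] [c d]. Qed.

Lemma ImD (x y : R[i]) : complex.Im (x + y) = complex.Im x + complex.Im y.
Proof. by case: x y => [a b] [c d]. Qed.

Definition cderive (F : 'rV[R]_4 -> R[i]) (v u : 'rV[R]_4) (d : R[i]) : Prop :=
  is_derive v u (fun w => complex.Re (F w)) (complex.Re d) /\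
  is_derive v u (fun w => complex.Im (F w)) (complex.Im d).

Lemma cderive_cst a v u : cderive (fun=> a) v u 0.
Proof. by split; exact: is_derive_cst. Qed.

Lemma cderiveM F G v u dF dG : cderive F v u dF -> cderive G v u dG ->
  cderive (fun w => F w * G w) v u (F v * dG + dF * G v).
Proof.
move=> [F1 F2] [G1 G2]; split.
  have -> : (fun w => complex.Re (F w * G w)) =
     (fun w => complex.Re (F w)) * (fun w => complex.Re (G w)) -
     (fun w => complex.Im (F w)) * (fun w => complex.Im (G w)).
    by apply/funext => w; rewrite ReM.
  apply: is_derive_eq (is_deriveB (is_deriveM F1 G1) (is_deriveM F2 G2)) _.
  by rewrite ReD !ReM /GRing.scale/=; ring.
have -> : (fun w => complex.Im (F w * G w)) =
   (fun w => complex.Re (F w)) * (fun w => complex.Im (G w)) +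
   (fun w => complex.Im (F w)) * (fun w => complex.Re (G w)).
  by apply/funext => w; rewrite ImM.
apply: is_derive_eq (is_deriveD (is_deriveM F1 G2) (is_deriveM F2 G1)) _.
by rewrite ImD !ImM /GRing.scale/=; ring.
Qed.

Lemma cderive_sum n (F : 'I_n -> 'rV[R]_4 -> R[i]) v u (d : 'I_n -> R[i]) :
  (forall i, cderive (F i) v u (d i)) ->
  cderive (fun w => \sum_(i < n) F i w) v u (\sum_(i < n) d i).
Proof.
move=> Fd; split.
  have -> : (fun w => complex.Re (\sum_(i < n) F i w)) =
      \sum_(i < n) (fun w => complex.Re (F i w)).
    by apply/funext => w; rewrite fct_sumE raddf_sum.
  rewrite raddf_sum; apply: is_derive_sum => i; exact: (Fd i).1.
have -> : (fun w => complex.Im (\sum_(i < n) F i w)) =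
    \sum_(i < n) (fun w => complex.Im (F i w)).
  by apply/funext => w; rewrite fct_sumE raddf_sum.
rewrite raddf_sum; apply: is_derive_sum => i; exact: (Fd i).2.
Qed.

Section Rotation.
Variables (wm wp : R).

Definition freq (j : 'I_2) : R := if j == 0 then wm else wp.

(* The Hamiltonian vector field of N, up to sign: z_j -> i w_j z_j. *)
Definition rot v : 'rV[R]_4 := \row_k
  (if odd k then (if (k < 2)%N then wm else wp) * v ord0 (inord k.-1)
   else - ((if (k < 2)%N then wm else wp) * v ord0 (inord k.+1))).

Lemma rot_cx v j : rot v ord0 (cx j) = - (freq j * v ord0 (cy j)).
Proof.
rewrite mxE cxE mul2n odd_double -mul2n; congr (- (_ * _)).
  by case: j => -[|[]].
by rewrite /cy addn1.
Qed.

Lemma rot_cy v j : rot v ord0 (cy j) = freq j * v ord0 (cx j).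
Proof.
rewrite mxE cyE mul2n /= odd_double -mul2n; congr (_ * _).
by case: j => -[|[]].
Qed.

(** The bracket read from the other side: by antisymmetry it also differentiates the quartic along
    the linear rotation field of N. *)
Lemma pb_rot (T : @tens R 4 4) v :
  pb (fun w => (ev T w)%:C) (Nham wm wp) v = (dv T v (rot v))%:C.
Proof.
rewrite Nham_real pb_real; congr (_%:C); rewrite !dv_pd !sum4.
have fE k : vfield (hfield T) v ord0 k = ev (hfield T k) v by rewrite mxE.
apply: eq_bigr => j _; rewrite !fE rot_cx rot_cy hfield_cx hfield_cy.
rewrite !ev_pd_Ntens.
have -> : (if (cx j < 2)%N then wm else wp) = freq j.
  by rewrite cxE; case: j => -[|[]].
have -> : (if (cy j < 2)%N then wm else wp) = freq j.
  by rewrite cyE; case: j => -[|[]].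
by field.
Qed.

(** The eigenvalue is i l, and l is its real frequency: frequencies add under products and change
    sign under conjugation. *)
Definition eigen (F : 'rV[R]_4 -> R[i]) (l : R) : Prop :=
  forall v, cderive F v (rot v) ('i * l%:C * F v).

Lemma eigenM F G l m : eigen F l -> eigen G m -> eigen (fun v => F v * G v) (l + m).
Proof.
move=> Fl Gm v; have := cderiveM (Fl v) (Gm v).
by congr cderive; rewrite rmorphD /=; ring.
Qed.

Lemma eigenX F l n : eigen F l -> eigen (fun v => F v ^+ n) (l * n%:R).
Proof.
move=> Fl; elim: n => [|n IH] v.
  rewrite mulr0 mulr0 mul0r (_ : (fun _ => _) = fun=> 1); first exact: cderive_cst.
  by apply/funext => w; rewrite expr0.
have := eigenM Fl IH v; congr cderive.
  by apply/funext => w; rewrite exprS.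
by rewrite exprS -natr1 mulrDr mulr1 addrC.
Qed.

Lemma eigen_zc j : eigen (fun v => zc v j) (freq j).
Proof.
move=> v; split=> /=.
  by apply: is_derive_eq (is_derive_coord v (rot v) (cx j)) _; rewrite rot_cx; ring.
by apply: is_derive_eq (is_derive_coord v (rot v) (cy j)) _; rewrite rot_cy; ring.
Qed.

Lemma eigen_conj F l : eigen F l -> eigen (fun v => Num.conj (F v)) (- l).
Proof.
move=> Fl v; have [F1 F2] := Fl v; split.
  rewrite (_ : (fun w => complex.Re (Num.conj (F w))) = (fun w => complex.Re (F w))).
    apply: is_derive_eq F1 _; rewrite -[Num.conj _]/(conjc _).
    by case: (F v) => x y /=; ring.
  by apply/funext => w; rewrite -[Num.conj _]/(conjc _); case: (F w).
rewrite (_ : (fun w => complex.Im (Num.conj (F w))) = - (fun w => complex.Im (F w))).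
  apply: is_derive_eq (is_deriveN F2) _; rewrite -[Num.conj _]/(conjc _).
  by case: (F v) => x y /=; ring.
by apply/funext => w; rewrite fctE -[Num.conj _]/(conjc _); case: (F w).
Qed.

Lemma eigen_mono a1 a2 b1 b2 : eigen (mono a1 a2 b1 b2) (wdot wm wp a1 a2 b1 b2).
Proof.
have h1 := eigen_zc 0; have h2 := eigen_zc 1.
have := eigenM (eigenM (eigenM (eigenX a1 h1) (eigenX a2 h2))
  (eigenX b1 (eigen_conj h1))) (eigenX b2 (eigen_conj h2)).
by congr eigen; rewrite /wdot /freq /=; ring.
Qed.

(** The derivative along [rot] is computed twice, from the real tensor (the bracket) and monomial by
    monomial (the eigenvalues). Uniqueness of derivatives identifies the results; the imaginary part
    is the derivative of 0. *)
Lemma pb_quartic c v : (forall a1 a2 b1 b2, Num.conj (c a1 a2 b1 b2) = c b1 b2 a1 a2) ->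
  pb (quartic c) (Nham wm wp) v =
  quartic (fun a1 a2 b1 b2 => 'i * (wdot wm wp a1 a2 b1 b2)%:C * c a1 a2 b1 b2) v.
Proof.
move=> cc; have [T TE] := quartic_real cc; rewrite TE pb_rot.
set c' := fun a1 a2 b1 b2 : nat => _.
have [d1 d2] : cderive (fun w => (ev T w)%:C) v (rot v) (quartic c' v).
  rewrite -TE /quartic.
  apply: cderive_sum => a1; apply: cderive_sum => a2.
  apply: cderive_sum => b1; apply: cderive_sum => b2.
  case: (boolP (a1 + a2 + b1 + b2 == 4)%N) => _; last exact: (cderive_cst 0).
  have := cderiveM (cderive_cst (c a1 a2 b1 b2) v (rot v)) (eigen_mono a1 a2 b1 b2 v).
  by congr cderive; rewrite /c' mul0r addr0; ring.
have e1 : is_derive v (rot v) (fun w : 'rV[R]_4 => ev T w) (dv T v (rot v)).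
  by apply: (@is_derive_ev _ _ _ id) => i; exact: is_derive_coord.
have e2 : is_derive v (rot v) (fun w : 'rV[R]_4 => 0 : R) 0 by exact: is_derive_cst.
have E1 : dv T v (rot v) = complex.Re (quartic c' v).
  exact: etrans (esym (@derive_val _ _ _ _ _ _ _ e1)) (@derive_val _ _ _ _ _ _ _ d1).
have E2 : 0 = complex.Im (quartic c' v).
  exact: etrans (esym (@derive_val _ _ _ _ _ _ _ e2)) (@derive_val _ _ _ _ _ _ _ d2).
by rewrite E1; case: (quartic c' v) E2 => x y /= <-.
Qed.

End Rotation.

End Homological.

(** * Coefficients of the model *)

Section Coefficients.
Context {R : realType}.
Local Open Scope complex_scope.
Implicit Types (v : 'rV[R]_4) (c d : nat -> nat -> nat -> nat -> R[i]).

Lemma eq_quartic c d v : (forall a1 a2 b1 b2, (a1 + a2 + b1 + b2 = 4)%N ->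
    c a1 a2 b1 b2 = d a1 a2 b1 b2) ->
  quartic c v = quartic d v.
Proof.
move=> cd; rewrite /quartic; do 4![apply: eq_bigr => ? _].
by case: eqP => // /cd ->.
Qed.

Lemma quarticD c d v :
  quartic c v + quartic d v =
  quartic (fun a1 a2 b1 b2 => c a1 a2 b1 b2 + d a1 a2 b1 b2) v.
Proof.
rewrite /quartic; do 4![rewrite -big_split; apply: eq_bigr => ? _].
by case: ifP => _ /=; rewrite ?addr0// mulrDl.
Qed.

Lemma quarticZ (k : R[i]) c v :
  k * quartic c v = quartic (fun a1 a2 b1 b2 => k * c a1 a2 b1 b2) v.
Proof.
rewrite /quartic; do 4![rewrite mulr_sumr; apply: eq_bigr => ? _].
by case: ifP => _; rewrite ?mulr0// mulrA.
Qed.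

Lemma big_ord5 (F : 'I_5 -> R[i]) : \sum_(i < 5) F i =
  F (@Ordinal 5 0 isT) + F (@Ordinal 5 1 isT) + F (@Ordinal 5 2 isT) +
  F (@Ordinal 5 3 isT) + F (@Ordinal 5 4 isT).
Proof.
rewrite !big_ord_recl big_ord0 addr0 !addrA.
by congr (F _ + F _ + F _ + F _ + F _); exact: val_inj.
Qed.

(** Solving the degree constraint for b2 cuts the explicit expansions from 625 terms to 125. *)
Lemma quartic_expand c v : quartic c v =
  \sum_(a1 < 5) \sum_(a2 < 5) \sum_(b1 < 5)
    if (a1 + a2 + b1 <= 4)%N then
      c a1 a2 b1 (4 - (a1 + a2 + b1))%N * mono a1 a2 b1 (4 - (a1 + a2 + b1)) v
    else 0.
Proof.
rewrite /quartic; apply: eq_bigr => a1 _; apply: eq_bigr => a2 _.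
apply: eq_bigr => b1 _; case: leqP => h; last first.
  by rewrite big1// => b2 _; case: eqP => // e; exfalso; lia.
have h5 : (4 - (a1 + a2 + b1) < 5)%N by lia.
rewrite (bigD1 (Ordinal h5))//= big1 ?addr0 => [|b2 b2n].
  by rewrite subnKC// eqxx.
case: eqP => // e; case/negP: b2n; apply/eqP/val_inj => /=; lia.
Qed.

Lemma quartic_multinomial (al be : R[i]) v :
  quartic (fun a1 a2 b1 b2 => 24%:R * (al ^+ (a1 + b1) * be ^+ (a2 + b2) /
    (a1`!%:R * a2`!%:R * b1`!%:R * b2`!%:R))) v =
  (al * (zc v 0 + Num.conj (zc v 0)) + be * (zc v 1 + Num.conj (zc v 1))) ^+ 4.
Proof.
(* Going back to the primitive addition and subtraction lets [/=] compute the exponents. *)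
rewrite quartic_expand !big_ord5 /mono -!plusE -!minusE /=.
have [f1 f2 f3 f4] : [/\ 1`! = 1, 2`! = 2, 3`! = 6 & 4`! = 24]%N by [].
rewrite !(fact0, f1, f2, f3, f4).
move: (zc v 0) (zc v 1) (Num.conj (zc v 0)) (Num.conj (zc v 1)) => z1 z2 z3 z4.
by field.
Qed.

Section Model.
Variables (Phi : 'M[R]_2) (M3 N3 wm wp : R).
Hypotheses (wm0 : 0 < wm) (wmp : wm < wp).

Lemma Gc_symm a1 a2 b1 b2 :
  Gc Phi M3 N3 wm wp a1 a2 b1 b2 = Gc Phi M3 N3 wm wp b1 b2 a1 a2.
Proof. by rewrite /Gc (addnC a1) (addnC a2) (mulrC a1`!%:R) (mulrC a2`!%:R). Qed.

Lemma wdot_antisym a1 a2 b1 b2 : wdot wm wp b1 b2 a1 a2 = - wdot wm wp a1 a2 b1 b2.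
Proof. by rewrite /wdot; ring. Qed.

Lemma wdot_resonant a1 a2 b1 b2 : wp != 3 * wm ->
  resonant_pair a1 a2 b1 b2 -> wdot wm wp a1 a2 b1 b2 != 0.
Proof.
move=> w3 /orP[] /eqP[-> -> -> ->]; rewrite /wdot; apply: contra w3 => /eqP w0;
  by apply/eqP; move: w0; lra.
Qed.

(** In degree 4 the components of a - b have an even sum. With opposite signs the combinations are,
    up to sign, wm - wp, 2 (wm - wp), wm - 3 wp and 3 wm - wp; only the last, the excluded pair, can
    vanish when 0 < wm < wp. *)
Lemma wdot_nonresonant a1 a2 b1 b2 : (a1 + a2 + b1 + b2 = 4)%N ->
  (a1, a2) != (b1, b2) ->
  ~~ resonant_pair a1 a2 b1 b2 -> wdot wm wp a1 a2 b1 b2 != 0.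
Proof.
have wp0 : 0 < wp by exact: lt_trans wmp.
move=> e; have [l1 l2 l3 l4] : [/\ (a1 < 5)%N, (a2 < 5)%N, (b1 < 5)%N & (b2 < 5)%N].
  by split; lia.
rewrite /wdot; move: l1 l2 l3 l4 e.
case: a1 => [|[|[|[|[|//]]]]] _; case: a2 => [|[|[|[|[|//]]]]] _;
case: b1 => [|[|[|[|[|//]]]]] _; case: b2 => [|[|[|[|[|//]]]]] _ // _ _ _ ;
  by apply/eqP; move: wm0 wp0 wmp; lra.
Qed.

(** The factorials of [fcoef] cancel against the binomials, leaving the multinomial coefficients of
    two fourth powers of linear forms; 6/4 = 24/16. *)
Lemma GcE a1 a2 b1 b2 : Gc Phi M3 N3 wm wp a1 a2 b1 b2 =
  16^-1 * M3 * (24%:R * ((Phi 0 0 / Num.sqrt wm) ^+ (a1 + b1)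
      * (Phi 0 1 / Num.sqrt wp) ^+ (a2 + b2) /
      (a1`!%:R * a2`!%:R * b1`!%:R * b2`!%:R))) +
  16^-1 * N3 * (24%:R * ((Phi 1 0 / Num.sqrt wm) ^+ (a1 + b1)
      * (Phi 1 1 / Num.sqrt wp) ^+ (a2 + b2) /
      (a1`!%:R * a2`!%:R * b1`!%:R * b2`!%:R))).
Proof.
have f0 k : k`!%:R != 0 :> R by rewrite pnatr_eq0 -lt0n fact_gt0.
have s0 : Num.sqrt wm != 0 by rewrite gt_eqF// sqrtr_gt0.
have t0 : Num.sqrt wp != 0 by rewrite gt_eqF// sqrtr_gt0 (lt_trans wm0).
rewrite /Gc /fcoef !expr_div_n.
have sX k : Num.sqrt wm ^+ k != 0 by rewrite expf_neq0.
have tX k : Num.sqrt wp ^+ k != 0 by rewrite expf_neq0.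
have := f0 (a1 + b1)%N; have := f0 (a2 + b2)%N; have := sX (a1 + b1)%N.
have := tX (a2 + b2)%N; have := f0 a1; have := f0 a2; have := f0 b1; have := f0 b2.
move: (a1 + b1)%N (a2 + b2)%N => i j.
move: (i`!%:R) (j`!%:R) (a1`!%:R) (a2`!%:R) (b1`!%:R) (b2`!%:R) => fi fj f1 f2 f3 f4.
move: (Num.sqrt wm ^+ i) (Num.sqrt wp ^+ j) => s t h1 h2 h3 h4 h5 h6 h7 h8.
by field; rewrite ?h1 ?h2 ?h3 ?h4 ?h5 ?h6 ?h7 ?h8.
Qed.

Lemma Gham_quartic v :
  Gham Phi M3 N3 wm wp v =
  quartic (fun a1 a2 b1 b2 => (Gc Phi M3 N3 wm wp a1 a2 b1 b2)%:C) v.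
Proof.
have s0 : Num.sqrt wm != 0 by rewrite gt_eqF// sqrtr_gt0.
have t0 : Num.sqrt wp != 0 by rewrite gt_eqF// sqrtr_gt0 (lt_trans wm0).
pose z1 := complex.Re (zc v 0 + (zc v 0)^*); pose z2 := complex.Re (zc v 1 + (zc v 1)^*).
have z1E : z1%:C = zc v 0 + Num.conj (zc v 0).
  by rewrite -[Num.conj _]/(conjc _) /z1; case: (zc v 0) => x y;
     apply/eqP; rewrite eq_complex /= subrr !eqxx.
have z2E : z2%:C = zc v 1 + Num.conj (zc v 1).
  by rewrite -[Num.conj _]/(conjc _) /z2; case: (zc v 1) => x y;
     apply/eqP; rewrite eq_complex /= subrr !eqxx.
have ffE : ff Phi M3 N3 (z1 / Num.sqrt (2 * wm)) (z2 / Num.sqrt (2 * wp)) =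
  16^-1 * M3 * (Phi 0 0 / Num.sqrt wm * z1 + Phi 0 1 / Num.sqrt wp * z2) ^+ 4 +
  16^-1 * N3 * (Phi 1 0 / Num.sqrt wm * z1 + Phi 1 1 / Num.sqrt wp * z2) ^+ 4.
  have q2 : Num.sqrt 2 != 0 :> R by rewrite gt_eqF// sqrtr_gt0.
  (* The factor 1/4 of f times this 1/4 gives the 1/16 of [GcE]. *)
  have r4 : (Num.sqrt 2)^-1 ^+ 4 = 4^-1 :> R.
    rewrite exprVn -[4%N]/(2 * 2)%N exprM sqr_sqrtr//.
    by congr (_^-1); ring.
  have lin (a b : R) : a * (z1 / Num.sqrt (2 * wm)) + b * (z2 / Num.sqrt (2 * wp)) =
      (Num.sqrt 2)^-1 * (a / Num.sqrt wm * z1 + b / Num.sqrt wp * z2).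
    by rewrite !sqrtrM//; field; rewrite q2 s0 t0.
  rewrite /ff !lin !exprMn r4.
  move: ((Phi 0 0 / _ * z1 + _) ^+ 4) ((Phi 1 0 / _ * z1 + _) ^+ 4) => a b.
  by field.
have powC (k x l y : R) : (k * x ^+ 4 + l * y ^+ 4)%:C =
    k%:C * x%:C ^+ 4 + l%:C * y%:C ^+ 4 :> R[i].
  by rewrite rmorphD [X in X + _]rmorphM [X in _ + X]rmorphM !rmorphXn.
have linC (a b x y : R) : (a * x + b * y)%:C = a%:C * x%:C + b%:C * y%:C :> R[i].
  by rewrite rmorphD !rmorphM.
rewrite /Gham -/z1 -/z2 ffE powC !linC z1E z2E.
rewrite -!quartic_multinomial !quarticZ quarticD.
apply: eq_quartic => a1 a2 b1 b2 _; rewrite GcE.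
by rewrite !(rmorphD, rmorphM, rmorphXn, fmorphV, rmorph_nat) /=.
Qed.

Lemma imag_coefE (x y : R) : 'i * x%:C / y%:C = 'i * (x / y)%:C :> R[i].
Proof. by rewrite -mulrA rmorphM fmorphV. Qed.

Lemma conj_imag (x : R) : Num.conj ('i * x%:C : R[i]) = 'i * (- x)%:C.
Proof.
rewrite -[Num.conj _]/(conjc _); apply/eqP; rewrite eq_complex /=.
by apply/andP; split; apply/eqP; ring.
Qed.

Lemma Snr_conj a1 a2 b1 b2 :
  Num.conj (Snr_coef Phi M3 N3 wm wp a1 a2 b1 b2) = Snr_coef Phi M3 N3 wm wp b1 b2 a1 a2.
Proof.
rewrite /Snr_coef [(b1, b2) == _]eq_sym; case: ifP => _; last exact: rmorph0.
by rewrite !imag_coefE conj_imag (wdot_antisym a1) (Gc_symm b1) invrN mulrN.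
Qed.

Lemma resonant_pairC a1 a2 b1 b2 : resonant_pair b1 b2 a1 a2 = resonant_pair a1 a2 b1 b2.
Proof.
rewrite /resonant_pair !xpair_eqE orbC -!andbA.
by congr (_ || _); do ?[case: (_ == _)%N => //=].
Qed.

Lemma Sres_conj a1 a2 b1 b2 :
  Num.conj (Sres_coef Phi M3 N3 wm wp a1 a2 b1 b2) = Sres_coef Phi M3 N3 wm wp b1 b2 a1 a2.
Proof.
rewrite /Sres_coef [(b1, b2) == _]eq_sym resonant_pairC.
case: ifP => _; last exact: rmorph0.
by rewrite !imag_coefE conj_imag (wdot_antisym a1) (Gc_symm b1) invrN mulrN.
Qed.

Lemma cancel_coef (x w : R) : w != 0 ->
  x%:C + 'i * w%:C * ('i * x%:C / w%:C) = 0 :> R[i].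
Proof.
move=> w0; rewrite imag_coefE; apply/eqP; rewrite eq_complex /=.
by apply/andP; split; apply/eqP; field.
Qed.

Lemma H4bar_quartic v : H4bar Phi M3 N3 wm wp v =
  quartic (fun a1 a2 b1 b2 => if (a1 == b1) && (a2 == b2) then
    (Gc Phi M3 N3 wm wp a1 a2 b1 b2)%:C else 0) v.
Proof.
rewrite quartic_expand /H4bar !big_ord5 !big_ord_recl !big_ord0 /bump /mono.
rewrite -!plusE -!minusE /= !(mul0r, addr0, add0r).
by rewrite !(expr0, mul1r, mulr1) !exprMn; ring.
Qed.

Lemma H4res_quartic v : H4res Phi M3 N3 wm wp v =
  quartic (fun a1 a2 b1 b2 => if ((a1 == b1) && (a2 == b2)) || resonant_pair a1 a2 b1 b2
    then (Gc Phi M3 N3 wm wp a1 a2 b1 b2)%:C else 0) v.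
Proof.
rewrite /H4res H4bar_quartic !quartic_expand !big_ord5 /mono.
rewrite -!plusE -!minusE /= !(mul0r, addr0, add0r).
by rewrite !(expr0, mul1r, mulr1) expr1; ring.
Qed.

Lemma homological_nonresonant v : wp != 3 * wm ->
  Gham Phi M3 N3 wm wp v + pb (Snr Phi M3 N3 wm wp) (Nham wm wp) v =
  H4bar Phi M3 N3 wm wp v.
Proof.
move=> w3; rewrite Gham_quartic (pb_quartic wm wp v Snr_conj) quarticD H4bar_quartic.
apply: eq_quartic => a1 a2 b1 b2 e; rewrite /Snr_coef -xpair_eqE.
have [_|ne] := eqVneq (a1, a2) (b1, b2); first by rewrite mulr0 addr0.
(* The assumption [wp != 3 * wm] serves exactly the resonant pair. *)
apply: cancel_coef; case: (boolP (resonant_pair a1 a2 b1 b2)) => r.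
  exact: wdot_resonant.
exact: wdot_nonresonant.
Qed.

Lemma homological_resonant v :
  Gham Phi M3 N3 wm wp v + pb (Sres Phi M3 N3 wm wp) (Nham wm wp) v =
  H4res Phi M3 N3 wm wp v.
Proof.
rewrite Gham_quartic (pb_quartic wm wp v Sres_conj) quarticD H4res_quartic.
apply: eq_quartic => a1 a2 b1 b2 e; rewrite /Sres_coef -xpair_eqE.
have [_|ne] := eqVneq (a1, a2) (b1, b2); first by rewrite mulr0 addr0.
(* On the resonant pair the generator has coefficient 0, so the term of G survives into the normal
   form. *)
case: (boolP (resonant_pair a1 a2 b1 b2)) => r /=; first by rewrite mulr0 addr0.
by apply: cancel_coef; exact: wdot_nonresonant.
Qed.

End Model.
End Coefficients.

Unset Implicit Arguments.

Theorem theorem4p2 (R : realType) (M K Phi : 'M[R]_2) (M3 N3 wm wp : R) :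
  M^T = M ->
  (forall u : 'rV[R]_2, u != 0 -> 0 < (u *m M *m u^T) 0 0) ->
  is_diag_mx K ->
  (forall u : 'rV[R]_2, u != 0 -> 0 < (u *m K *m u^T) 0 0) ->
  0 < wm -> wm < wp ->
  eigenvalue (invmx M *m K) (wm ^+ 2) ->
  eigenvalue (invmx M *m K) (wp ^+ 2) ->
  Phi^T *m M *m Phi = 1%:M ->
  Phi^T *m K *m Phi = diag_mx (\row_(i < 2) (if i == 0 then wm ^+ 2 else wp ^+ 2)) ->
  normal_form Phi M3 N3 wm wp (Sres Phi M3 N3 wm wp) (H4res Phi M3 N3 wm wp) /\
  (wp != 3 * wm ->
   normal_form Phi M3 N3 wm wp (Snr Phi M3 N3 wm wp) (H4bar Phi M3 N3 wm wp)).
Proof.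
move=> _ _ _ _ wm0 wmp _ _ _ _; split=> [|w3].
  have [T TE] := quartic_real (@Sres_conj R Phi M3 N3 wm wp).
  by apply: normal_form_real TE _ => v; exact: homological_resonant.
have [T TE] := quartic_real (@Snr_conj R Phi M3 N3 wm wp).
by apply: normal_form_real TE _ => v; exact: homological_nonresonant.
Qed.
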